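(* Let $(M,\varphi,\xi,\eta,g)$ be a Kenmotsu manifold of dimension $2n+1$. Suppose $g$ is a gradient almost $*$-Ricci soliton, i.e. there are smooth functions $f,\lambda$ on $M$ with $$\mathrm{Hess}\, f+S^*+\lambda g=0,$$ and let $V=Df$ be the soliton vector field. Then either $M$ is Einstein, or there is a nonempty open set $\mathcal{O}\subseteq M$ on which $V$ is pointwise collinear with the characteristic vector field $\xi$.
   Context: All manifolds, tensors and functions are smooth; $\mathfrak{X}(M)$ denotes the vector fields on $M$; $\nabla$ is the Levi-Civita connection of $g$; $Df$ is the gradient of $f$ with respect to $g$ and $\mathrm{Hess}\,f(X,Y)=g(\nabla_X Df,Y)$. An almost contact metric manifold $(M,\varphi,\xi,\eta,g)$ of dimension $2n+1$ ($n\ge 1$) is a smooth manifold with a $(1,1)$-tensor field $\varphi$, a vector field $\xi$ (the characteristic vector field), a 1-form $\eta$ and a Riemannian metric $g$ such that $\varphi^2=-I+\eta\otimes\xi$, $\eta(\xi)=1$ and $g(\varphi X,\varphi Y)=g(X,Y)-\eta(X)\eta(Y)$ for all $X,Y\in\mathfrak{X}(M)$. It is called Kenmotsu if $(\nabla_X\varphi)Y=g(\varphi X,Y)\xi-\eta(Y)\varphi X$ for all $X,Y\in\mathfrak{X}(M)$. The curvature convention is $R(X,Y)=[\nabla_X,\nabla_Y]-\nabla_{[X,Y]}$; the Ricci tensor is $S(Y,Z)=\mathrm{trace}(X\mapsto R(X,Y)Z)$. The $*$-Ricci tensor is $S^*(X,Y)=\frac12\,\mathrm{trace}\big(Z\mapsto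 R(X,\varphi Y)\varphi Z\big)$. $M$ is Einstein if $S=ag$ for some constant $a$. Pointwise collinear on $\mathcal{O}$ means $V=h\xi$ on $\mathcal{O}$ for some function $h$ on $\mathcal{O}$. *)

(* Defs.v *)
From HB Require Import structures.
From mathcomp Require Import all_boot all_order all_algebra.
From mathcomp Require Import all_classical all_reals all_analysis.

Set Implicit Arguments.
Unset Strict Implicit.
Unset Printing Implicit Defensive.
Import Order.TTheory GRing.Theory Num.Theory.
Import numFieldNormedType.Exports.
Local Open Scope classical_set_scope.
Local Open Scope ring_scope.

(* C^k maps on an open subset U of a finite-dimensional normed space. *)
Fixpoint is_Ck (R : realType) (V W : normedModType R) (k : nat)
    (U : set V) (f : V -> W) : Prop :=
  match k with
  | 0 => forall x, U x -> {for x, continuous f}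
  | k'.+1 => (forall x, U x -> differentiable f x) /\
             (forall v : V, is_Ck k' U (fun x => 'd f x v))
  end.

Definition smooth_on (R : realType) (V W : normedModType R)
  (U : set V) (f : V -> W) : Prop := forall k, is_Ck k U f.

(* [fwd] and [bwd] are total functions; they are only meaningful on [dom] and
   on [fwd @` dom] respectively. *)
Record chart (R : realType) (m : nat) (T : topologicalType) := Chart {
  dom : set T;
  fwd : T -> 'cV[R]_m;
  bwd : 'cV[R]_m -> T;
  open_dom : open dom;
  open_img : open (fwd @` dom);
  fwdK : forall x, dom x -> bwd (fwd x) = x;
  fwd_continuous : forall x, dom x -> {for x, continuous fwd};
  bwd_continuous : forall y, (fwd @` dom) y -> {for y, continuous bwd} }.

(* The atlas is the family of the charts [at_ x], with x in the domain of
   [at_ x]; every atlas contains a subatlas that can be indexed in this way and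
   defines the same smooth structure.  Singling out a chart around each point
   lets us identify the tangent space T_x M with R^m, through the coordinates of
   the chart [at_ x]: tangent vectors at x are column vectors, covectors are row
   vectors, endomorphisms and bilinear forms of T_x M are square matrices.
   (This identification depends on x, so that smoothness and differentiation of
   a vector field always involve the change of coordinates [tchange] below.) *)
Record manifold (R : realType) (m : nat) := Manifold {
  points :> topologicalType;
  at_ : points -> chart R m points;
  manifold_hausdorff : hausdorff_space points;
  manifold_second_countable : @second_countable points;
  at_dom : forall x, dom (at_ x) x;
  at_compatible : forall p q,
    smooth_on (fwd (at_ p) @` (dom (at_ p) `&` dom (at_ q)))
              (fwd (at_ q) \o bwd (at_ p)) }.

Definition vector_field (R : realType) (m : nat) (M : manifold R m) : Type :=
  M -> 'cV[R]_m.

(* At the point x, the linear map turning the components of a tangent vector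
   with respect to the chart at p into those with respect to the chart at q. *)
Definition tchange (R : realType) (m : nat) (M : manifold R m) (p q x : M)
    (v : 'cV[R]_m) : 'cV[R]_m :=
  'd (fwd (at_ q) \o bwd (at_ p)) (fwd (at_ p) x) v.

(* The components of X in the chart at q (on the domain of this chart). *)
Definition comp_in (R : realType) (m : nat) (M : manifold R m) (q : M)
    (X : vector_field M) : M -> 'cV[R]_m :=
  fun x => tchange x q x (X x).

(* Smoothness of functions and fields is over an open set U, the values outside
   of U being irrelevant: local fields are represented by total functions. *)
Definition smooth_fun (R : realType) (m : nat) (M : manifold R m)
    (U : set M) (f : M -> R) : Prop :=
  forall q : M, smooth_on (fwd (at_ q) @` (U `&` dom (at_ q)))
                          (f \o bwd (at_ q) : 'cV[R]_m -> R^o).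

Definition smooth_vf (R : realType) (m : nat) (M : manifold R m)
    (U : set M) (X : vector_field M) : Prop :=
  forall q : M, smooth_on (fwd (at_ q) @` (U `&` dom (at_ q)))
                          (comp_in q X \o bwd (at_ q)).

(* Tensor fields: values on vectors, and smoothness, i.e., smoothness of the
   values on all smooth local vector fields. *)
Definition form_at (R : realType) (m : nat) (M : manifold R m)
  (eta : M -> 'rV[R]_m) (x : M) (u : 'cV[R]_m) : R := (eta x *m u) 0 0.

Definition bil_at (R : realType) (m : nat) (M : manifold R m)
  (g : M -> 'M[R]_m) (x : M) (u v : 'cV[R]_m) : R := (u^T *m g x *m v) 0 0.

Definition smooth_form (R : realType) (m : nat) (M : manifold R m)
    (eta : M -> 'rV[R]_m) : Prop :=
  forall (U : set M) (X : vector_field M), open U -> smooth_vf U X ->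
    smooth_fun U (fun x => form_at eta x (X x)).

Definition smooth_endo (R : realType) (m : nat) (M : manifold R m)
    (phi : M -> 'M[R]_m) : Prop :=
  forall (U : set M) (X : vector_field M), open U -> smooth_vf U X ->
    smooth_vf U (fun x => phi x *m X x).

Definition smooth_bil (R : realType) (m : nat) (M : manifold R m)
    (g : M -> 'M[R]_m) : Prop :=
  forall (U : set M) (X Y : vector_field M),
    open U -> smooth_vf U X -> smooth_vf U Y ->
    smooth_fun U (fun x => bil_at g x (X x) (Y x)).

Record riemannian_metric (R : realType) (m : nat) (M : manifold R m)
    (g : M -> 'M[R]_m) : Prop := RiemannianMetric {
  metric_smooth : smooth_bil g;
  metric_sym : forall x u v, bil_at g x u v = bil_at g x v u;
  metric_pos : forall x u, u != 0 -> 0 < bil_at g x u u }.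

(* The derivative v f of the function f along the tangent vector v at x. *)
Definition dfun (R : realType) (m : nat) (M : manifold R m)
    (f : M -> R) (x : M) (v : 'cV[R]_m) : R :=
  'd (f \o bwd (at_ x) : 'cV[R]_m -> R^o) (fwd (at_ x) x) v.

(* The solution Df of g(Df, v) = v f for all v. *)
Definition grad (R : realType) (m : nat) (M : manifold R m)
    (g : M -> 'M[R]_m) (f : M -> R) : vector_field M :=
  fun x => invmx (g x) *m \col_i dfun f x (delta_mx i 0).

(* [X, Y] in coordinates: DY(X) - DX(Y). *)
Definition bracket (R : realType) (m : nat) (M : manifold R m)
    (X Y : vector_field M) : vector_field M :=
  fun x => 'd (comp_in x Y \o bwd (at_ x)) (fwd (at_ x) x) (X x)
         - 'd (comp_in x X \o bwd (at_ x)) (fwd (at_ x) x) (Y x).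

(* [nabla x u Y] is the covariant derivative at x of the field Y along the
   tangent vector u at x, meaningful for Y smooth on a neighborhood of x. *)
Definition cov (R : realType) (m : nat) (M : manifold R m)
    (nabla : M -> 'cV[R]_m -> vector_field M -> 'cV[R]_m)
    (X Y : vector_field M) : vector_field M :=
  fun x => nabla x (X x) Y.

Record affine_connection (R : realType) (m : nat) (M : manifold R m)
    (nabla : M -> 'cV[R]_m -> vector_field M -> 'cV[R]_m) : Prop :=
  AffineConnection {
  conn_smooth : forall (U : set M) (X Y : vector_field M),
    open U -> smooth_vf U X -> smooth_vf U Y -> smooth_vf U (cov nabla X Y);
  conn_linear : forall (U : set M) (Y : vector_field M),
    open U -> smooth_vf U Y -> forall x, U x -> forall (a : R) u v,
    nabla x (a *: u + v) Y = a *: nabla x u Y + nabla x v Y;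
  conn_additive : forall (U : set M) (Y Z : vector_field M),
    open U -> smooth_vf U Y -> smooth_vf U Z -> forall x, U x -> forall u,
    nabla x u (fun y => Y y + Z y) = nabla x u Y + nabla x u Z;
  conn_leibniz : forall (U : set M) (f : M -> R) (Y : vector_field M),
    open U -> smooth_fun U f -> smooth_vf U Y -> forall x, U x -> forall u,
    nabla x u (fun y => f y *: Y y) = dfun f x u *: Y x + f x *: nabla x u Y }.

Record levi_civita (R : realType) (m : nat) (M : manifold R m)
    (g : M -> 'M[R]_m)
    (nabla : M -> 'cV[R]_m -> vector_field M -> 'cV[R]_m) : Prop :=
  LeviCivita {
  lc_connection : affine_connection nabla;
  lc_torsion_free : forall (U : set M) (X Y : vector_field M),
    open U -> smooth_vf U X -> smooth_vf U Y -> forall x, U x ->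
    cov nabla X Y x - cov nabla Y X x = bracket X Y x;
  lc_metric : forall (U : set M) (Y Z : vector_field M),
    open U -> smooth_vf U Y -> smooth_vf U Z -> forall x, U x -> forall u,
    dfun (fun y => bil_at g y (Y y) (Z y)) x u =
      bil_at g x (nabla x u Y) (Z x) + bil_at g x (Y x) (nabla x u Z) }.

Definition curvature (R : realType) (m : nat) (M : manifold R m)
    (nabla : M -> 'cV[R]_m -> vector_field M -> 'cV[R]_m)
    (X Y Z : vector_field M) : vector_field M :=
  fun x => cov nabla X (cov nabla Y Z) x - cov nabla Y (cov nabla X Z) x
         - cov nabla (bracket X Y) Z x.

(* The extension of a tangent vector v at p to the smooth vector field, on the
   domain of the chart at p, with constant components in this chart. *)
Definition extend (R : realType) (m : nat) (M : manifold R m) (p : M)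
    (v : 'cV[R]_m) : vector_field M :=
  fun x => tchange p x x v.

(* R(u, v)w for tangent vectors at p; by tensoriality of the curvature the
   choice of the local extensions is irrelevant. *)
Definition curvature_at (R : realType) (m : nat) (M : manifold R m)
    (nabla : M -> 'cV[R]_m -> vector_field M -> 'cV[R]_m)
    (p : M) (u v w : 'cV[R]_m) : 'cV[R]_m :=
  curvature nabla (extend p u) (extend p v) (extend p w) p.

(* The trace of a linear endomorphism A of R^m. *)
Definition endo_trace (R : realType) (m : nat)
    (A : 'cV[R]_m -> 'cV[R]_m) : R :=
  \tr (\matrix_(i < m, j < m) A (delta_mx j 0) i 0).

Definition ricci (R : realType) (m : nat) (M : manifold R m)
    (nabla : M -> 'cV[R]_m -> vector_field M -> 'cV[R]_m)
    (p : M) (v w : 'cV[R]_m) : R :=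
  endo_trace (fun u => curvature_at nabla p u v w).

Definition star_ricci (R : realType) (m : nat) (M : manifold R m)
    (nabla : M -> 'cV[R]_m -> vector_field M -> 'cV[R]_m)
    (phi : M -> 'M[R]_m) (p : M) (u v : 'cV[R]_m) : R :=
  2%:R^-1 *
  endo_trace (fun w => curvature_at nabla p u (phi p *m v) (phi p *m w)).

Definition hess (R : realType) (m : nat) (M : manifold R m)
    (g : M -> 'M[R]_m)
    (nabla : M -> 'cV[R]_m -> vector_field M -> 'cV[R]_m)
    (f : M -> R) (p : M) (u v : 'cV[R]_m) : R :=
  bil_at g p (nabla p u (grad g f)) v.

Record almost_contact_metric (R : realType) (m : nat) (M : manifold R m)
    (phi : M -> 'M[R]_m) (xi : vector_field M) (eta : M -> 'rV[R]_m)
    (g : M -> 'M[R]_m) : Prop := AlmostContactMetric {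
  acm_phi_smooth : smooth_endo phi;
  acm_xi_smooth : smooth_vf setT xi;
  acm_eta_smooth : smooth_form eta;
  acm_metric : riemannian_metric g;
  acm_phi2 : forall x u,
    phi x *m (phi x *m u) = - u + form_at eta x u *: xi x;
  acm_eta_xi : forall x, form_at eta x (xi x) = 1;
  acm_compatible : forall x u v,
    bil_at g x (phi x *m u) (phi x *m v) =
      bil_at g x u v - form_at eta x u * form_at eta x v }.

Record kenmotsu (R : realType) (m : nat) (M : manifold R m)
    (phi : M -> 'M[R]_m) (xi : vector_field M) (eta : M -> 'rV[R]_m)
    (g : M -> 'M[R]_m)
    (nabla : M -> 'cV[R]_m -> vector_field M -> 'cV[R]_m) : Prop := Kenmotsu {
  kenmotsu_acm : almost_contact_metric phi xi eta g;
  kenmotsu_levi_civita : levi_civita g nabla;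
  (* (nabla_X phi) Y = nabla_X (phi Y) - phi (nabla_X Y) *)
  kenmotsu_eq : forall (U : set M) (X Y : vector_field M),
    open U -> smooth_vf U X -> smooth_vf U Y -> forall x, U x ->
    cov nabla X (fun y => phi y *m Y y) x - phi x *m cov nabla X Y x =
      bil_at g x (phi x *m X x) (Y x) *: xi x
      - form_at eta x (Y x) *: (phi x *m X x) }.

Definition einstein (R : realType) (m : nat) (M : manifold R m)
    (g : M -> 'M[R]_m)
    (nabla : M -> 'cV[R]_m -> vector_field M -> 'cV[R]_m) : Prop :=
  exists a : R, forall (x : M) (u v : 'cV[R]_m),
    ricci nabla x u v = a * bil_at g x u v.

(* Main.v *)
(* Write b = g, e = eta, K for the curvature, S' for the *-Ricci tensor, m for
   the dimension 2n + 1, and a = xi(f + lambda), called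
   potential below.  The Kenmotsu condition
   determines nabla xi and K(., .)xi, and the commutator of K(X, Y) with phi;
   with the first Bianchi identity the latter gives
   S' = S + (m - 2) b + e (x) e, while the second Bianchi identity gives
   (nabla_xi K)(X, Y)Z = - 2 (K(X, Y)Z + b(Y, Z) X - b(X, Z) Y) and, taking
   traces, nabla_xi S' = - 2 S' - 2 (b - e (x) e).  The soliton equation turns
   the latter derivative into one of nabla Df, which is a curvature term
   K(xi, X)Df; comparing the two, d(f + lambda) = a e and
   S' = (a - 2)(b - e (x) e).  Then nabla Df is explicit, and the trace of
   K(., v)Df yields (a - 1)(v f - e(v) xi f) = 0 for all v.  Where a <> 1, the
   gradient is (xi f) xi; if a = 1 everywhere, then S = - (m - 1) b. *)

From HB Require Import structures.
Require Import Defs.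
From mathcomp Require Import all_boot all_order all_algebra.
From mathcomp Require Import all_classical all_reals all_analysis.
From mathcomp Require Import ring lra.
Import Order.TTheory GRing.Theory Num.Theory.
Import numFieldNormedType.Exports.
Local Open Scope classical_set_scope.
Local Open Scope ring_scope.
Set Implicit Arguments.
Unset Strict Implicit.
Unset Printing Implicit Defensive.

(** * Calculus of C^k maps *)

(** A tangent vector at [x] is written in the chart [at_ x], which may jump with [x], so the entries
    of a field or of [g x] need not be continuous in [x]. Smoothness and derivatives are therefore
    taken in the frame [extend p (delta_mx i 0)] of one fixed chart. [nabla] is known only through
    its axioms: no Christoffel symbols are computed, most rules for the bracket come from vanishing
    torsion, and identities are proved for local fields and brought to a point by tensoriality.
    Several facts make the soliton argument close. Since phi xi = 0, phi is parallel along xi, so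
    tracing nabla_xi K differentiates S' directly, and S'(., xi) = 0. Symmetry of the Hessian makes
    S' symmetric, hence nabla_xi Df = - lambda xi. Commuting nabla_xi with nabla_X on Df only costs
    K(xi, X)Df, which is explicit on every Kenmotsu manifold. Finally e is closed, so d(f + lambda)
    = a e forces da to be a multiple of e. *)

Section SmoothCalculus.
Variables (R : realType) (V : normedModType R).
Implicit Types (U : set V).

(** The first-order expansion of [f] involves only its germ at [x], and [diff_unique] identifies the
    differentials. Chart expressions agree only on images of chart domains, so all later comparisons
    of charts rest on this. *)
Lemma near_eq_diff (W : normedModType R) (f g : V -> W) (x : V) :
  (\near x, f x = g x) -> differentiable f x ->
  differentiable g x /\ 'd g x = 'd f x :> (V -> W).
Proof.
move=> fg df.
have gE : g \o shift x = cst (g x) + 'd f x +o_ 0 id.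
  rewrite -(nbhs_singleton fg).
  apply/eqaddoP => e e0.
  have /eqaddoP /(_ e e0) := diff_locally df.
  have fg0 : \forall h \near 0, f (h + x) = g (h + x).
    by move: fg; rewrite (near_shift 0 x); apply: filterS => h /=; rewrite subr0.
  by apply: filterS2 fg0 => h fgh; rewrite !fctE /= fgh.
have cf := diff_continuous df.
have dgE := diff_unique cf gE.
split; last exact: dgE.
by apply: (diff_locallyP x g).2; rewrite dgE; split; [exact: cf|exact: gE].
Qed.

Lemma is_Ck_ext (W : normedModType R) k U (f g : V -> W) : open U ->
  (forall x, U x -> f x = g x) -> is_Ck k U f -> is_Ck k U g.
Proof.
elim: k f g => [|k IH] f g oU fg /=.
  move=> cf x Ux; have fgx : {near x, f =1 g}.
    by apply: filterS (open_nbhs_nbhs (conj oU Ux)) => y /fg.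
  change (g @ x --> g x); rewrite -(fg x Ux).
  by apply: cvg_trans (cf x Ux); apply: near_eq_cvg; apply: filterS fgx.
move=> [df Hd].
have H x : U x -> differentiable g x /\ 'd g x = 'd f x :> (V -> W).
  move=> Ux; apply: near_eq_diff (df x Ux).
  by apply: filterS (open_nbhs_nbhs (conj oU Ux)) => y /fg.
split=> [x /H []|v]; first exact.
by apply: (IH (fun x => 'd f x v) _ oU _ (Hd v)) => x /H [_ ->].
Qed.

Lemma is_Ck_sub (W : normedModType R) k U U' (f : V -> W) :
  U' `<=` U -> is_Ck k U f -> is_Ck k U' f.
Proof.
elim: k f => [|k IH] f sU /=; first by move=> H x /sU /H.
by move=> [H1 H2]; split=> [x /sU /H1 //|v]; apply: IH.
Qed.

(** Every clause of [is_Ck] is a condition at the points of the set, so the witnessing set may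
    depend on the point. *)
Lemma is_Ck_pt (W : normedModType R) k U (f : V -> W) :
  (forall x, U x -> exists2 U', U' x & is_Ck k U' f) -> is_Ck k U f.
Proof.
elim: k f => [|k IH] f /= H.
  by move=> x /H [U' U'x]; apply.
split=> [x /H [U' U'x [df _]]|v]; first exact: df.
by apply: IH => x /H [U' U'x [_ df]]; exists U'.
Qed.

Lemma is_CkS (W : normedModType R) k U (f : V -> W) :
  is_Ck k.+1 U f -> is_Ck k U f.
Proof.
elim: k f => [|k IH] f [H1 H2].
  by move=> x /H1 /differentiable_continuous.
by split=> // v; apply: IH.
Qed.

Lemma is_Ck_cst (W : normedModType R) k U (c : W) : is_Ck k U (fun=> c).
Proof.
elim: k c => [|k IH] c /=; first by move=> x _; exact: cvg_cst.
split=> [x _|v]; first exact: differentiable_cst.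
by rewrite (_ : (fun x => _) = fun=> 0) //; apply/funext => x; rewrite diff_cst.
Qed.

Lemma is_CkD (W : normedModType R) k U (f g : V -> W) : open U ->
  is_Ck k U f -> is_Ck k U g -> is_Ck k U (fun x => f x + g x).
Proof.
elim: k f g => [|k IH] f g oU /=.
  by move=> cf cg x Ux; apply: cvgD; [exact: cf|exact: cg].
move=> [df Hf] [dg Hg]; split=> [x Ux|v].
  by apply: differentiableD; [exact: df|exact: dg].
apply: (is_Ck_ext oU) (IH _ _ oU (Hf v) (Hg v)) => x Ux.
exact/esym/(congr1 (@^~ v) (diffD (df x Ux) (dg x Ux))).
Qed.

Lemma is_Ck_lin (W W' : normedModType R) k U (L : {linear W -> W'})
    (f : V -> W) : continuous L -> open U ->
  is_Ck k U f -> is_Ck k U (fun x => L (f x)).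
Proof.
move=> cL oU; elim: k f => [|k IH] f /=.
  by move=> cf x Ux; apply: continuous_comp; [exact: cf|exact: cL].
move=> [df Hf]; split=> [x Ux|v].
  apply: differentiable_comp; first exact: df.
  exact: linear_differentiable.
apply: (is_Ck_ext oU) (IH _ (Hf v)) => x Ux.
have dL := @linear_differentiable _ _ _ L (f x) cL.
by rewrite [in RHS](diff_comp (df x Ux) dL) /= diff_lin.
Qed.

Lemma is_Ck_sum (W : normedModType R) n k U (f : 'I_n -> V -> W) :
  open U -> (forall i, is_Ck k U (f i)) -> is_Ck k U (fun x => \sum_i f i x).
Proof.
move=> oU; elim: n f => [|n IH] f H.
  by rewrite (_ : (fun x => _) = fun=> 0) ?funeqE => [|x]; [exact: is_Ck_cst|rewrite big_ord0].
rewrite (_ : (fun x => _) = fun x => \sum_(i < n) f (lift ord0 i) x + f ord0 x).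
  exact: is_CkD (IH _ _) _.
by rewrite funeqE => x; rewrite big_ord_recl addrC.
Qed.

Lemma is_CkM k U (f g : V -> R^o) : open U ->
  is_Ck k U f -> is_Ck k U g -> is_Ck k U (fun x => f x * g x : R^o).
Proof.
elim: k f g => [|k IH] f g oU.
  by move=> cf cg x Ux; apply: cvgM; [exact: cf|exact: cg].
move=> Cf Cg; have [df Hf] := Cf; have [dg Hg] := Cg; split=> [x Ux|v].
  by apply: differentiableM; [exact: df|exact: dg].
have := is_CkD oU (IH _ _ oU (is_CkS Cf) (Hg v)) (IH _ _ oU (is_CkS Cg) (Hf v)).
apply: (is_Ck_ext oU) => x Ux.
exact/esym/(congr1 (@^~ v) (diffM (df x Ux) (dg x Ux))).
Qed.

Lemma is_CkV k U (f : V -> R^o) : open U -> (forall x, U x -> f x != 0) ->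
  is_Ck k U f -> is_Ck k U (fun x => (f x)^-1 : R^o).
Proof.
move=> oU f0; elim: k => [|k IH].
  by move=> cf x Ux; apply: cvgV; [exact: f0|exact: cf].
move=> Cf; have [df Hf] := Cf; split=> [x Ux|v].
  by apply: differentiableV; [exact: df|exact: f0].
(* The derivative of the inverse is expressed by the inverse itself, as -1 times its square times
   ['d f], so that the induction hypothesis applies. *)
have CV := IH (is_CkS Cf).
have C2 := is_CkM oU (is_Ck_cst k U (-1 : R^o)) (is_CkM oU CV CV).
apply: (is_Ck_ext oU) (is_CkM oU C2 (Hf v)) => x Ux.
by rewrite [in RHS](diffV (df x Ux) (f0 x Ux)) /= expr2 invfM mulN1r.
Qed.

End SmoothCalculus.

(** * Symmetry of second derivatives *)

Section Schwarz.
Variables (R : realType) (V : normedModType R).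
Implicit Types (U : set V) (f : V -> R^o).

Lemma diff_shift (W : normedModType R) (f : V -> W) (x c : V) :
  differentiable f (x + c) ->
  differentiable (fun y => f (y + c)) x /\
  'd (fun y => f (y + c)) x = 'd f (x + c) :> (V -> W).
Proof.
move=> df.
have ds : is_diff x (fun y : V => y + c) id.
  have := is_diffD (is_diff_id x) (is_diff_cst c x).
  by rewrite addr0.
split; first exact: differentiable_comp (@ex_diff _ _ _ _ _ _ _ ds) df.
rewrite (diff_comp (@ex_diff _ _ _ _ _ _ _ ds) df).
by rewrite (@diff_val _ _ _ _ _ _ _ ds).
Qed.

Lemma mvt_segment f (x w : V) (h : R) : 0 < h ->
  (forall t, 0 <= t <= h -> differentiable f (x + t *: w)) ->
  exists2 t, 0 <= t <= h & f (x + h *: w) - f x = h * 'd f (x + t *: w) w.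
Proof.
move=> h0 df.
pose l (t : R) := x + t *: w.
have dl t : is_diff t l ( *:%R^~ w).
  have := is_diffD (is_diff_cst x t) (is_diff_scalel t w).
  by rewrite add0r.
have dfl t : 0 <= t <= h -> is_derive t 1 (f \o l) ('d f (x + t *: w) w).
  move=> t01; have D := differentiable_comp (@ex_diff _ _ _ _ _ _ _ (dl t)) (df t t01).
  apply: DeriveDef; first exact: diff_derivable.
  rewrite (deriveE _ D) (diff_comp (@ex_diff _ _ _ _ _ _ _ (dl t)) (df t t01)).
  by rewrite (@diff_val _ _ _ _ _ _ _ (dl t)) /= scale1r.
have [| |t] := @MVT R (f \o l) (fun t => 'd f (x + t *: w) w) 0 h h0.
- by move=> t; rewrite in_itv /= => /andP[t0 th]; apply: dfl; rewrite !ltW.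
- apply: derivable_within_continuous => t; rewrite in_itv /= => /dfl.
  by case.
rewrite in_itv /= => /andP[t0 th].
rewrite /l /= scale0r addr0 subr0 mulrC => E.
by exists t => //; rewrite !ltW.
Qed.

(** The mean value theorem is used twice: along [v] for y |-> f(y + h w) - f(y), then along [w] for
    the derivative of [f] in direction [v]. *)
Lemma second_difference f U (x v w : V) (h : R) : 0 < h ->
  (forall s t, 0 <= s <= h -> 0 <= t <= h -> U (x + s *: v + t *: w)) ->
  is_Ck 2 U f ->
  exists s t, [/\ 0 <= s <= h, 0 <= t <= h &
    f (x + h *: v + h *: w) - f (x + h *: v) - (f (x + h *: w) - f x) =
    h * (h * 'd (fun y => 'd f y v) (x + s *: v + t *: w) w)].
Proof.
move=> h0 HU [df ddf].
have hh : 0 <= h <= h by rewrite lexx ltW.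
have h00 : 0 <= (0:R) <= h by rewrite lexx ltW.
have U0 s : 0 <= s <= h -> U (x + s *: v).
  by move=> /HU /(_ h00); rewrite scale0r addr0.
have dshift s : 0 <= s <= h -> differentiable (fun y => f (y + h *: w)) (x + s *: v) /\
   'd (fun y => f (y + h *: w)) (x + s *: v) = 'd f (x + s *: v + h *: w) :> (V -> R).
  by move=> sh; apply: diff_shift; apply: df; exact: HU.
have [|s sh Es] := @mvt_segment (fun y => f (y + h *: w) - f y) x v h h0.
  move=> s sh; apply: differentiableB; first exact: (dshift s sh).1.
  exact/df/U0.
have Es' := congr1 (@^~ v) (diffB (dshift s sh).1 (df _ (U0 s sh))).
have [|t th Et] := @mvt_segment (fun y => 'd f y v) (x + s *: v) w h h0.
  by move=> t th; apply: (ddf v).1; exact: HU.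
exists s, t; split=> //; rewrite -Et.
rewrite Es; congr (_ * _).
exact: etrans Es' (congr1 (fun F => F v - _) (dshift s sh).2).
Qed.

(* By the mean value theorem, both mixed derivatives are limits of the same
   second difference. *)
Theorem schwarz f U (x v w : V) : open U -> U x -> is_Ck 2 U f ->
  'd (fun y => 'd f y v) x w = 'd (fun y => 'd f y w) x v.
Proof.
move=> oU Ux Cf.
pose A y := 'd (fun y => 'd f y v) y w; pose B y := 'd (fun y => 'd f y w) y v.
have cA : A y @[y --> x] --> A x by exact: ((Cf.2 v).2 w x Ux).
have cB : B y @[y --> x] --> B x by exact: ((Cf.2 w).2 v x Ux).
rewrite -[LHS]/(A x) -[RHS]/(B x); apply/eqP; rewrite -subr_eq0 -normr_le0.
apply/ler_addgt0Pr => e e0; rewrite add0r.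
have e2 : 0 < e / 2 by rewrite divr_gt0.
have : \forall y \near x, [/\ U y, `|A x - A y| < e / 2 & `|B x - B y| < e / 2].
  have nU := open_nbhs_nbhs (conj oU Ux).
  move: cA cB => /cvgrPdist_lt /(_ _ e2) nA /cvgrPdist_lt /(_ _ e2) nB.
  by apply: filterS3 nU nA nB.
move=> /nbhs_ballP[d /= d0 Hd].
(* The parallelogram stays in the ball because h (|v| + |w|) <= d / 2 < d; the summand 1 keeps the
   denominator positive when [v] and [w] vanish. *)
pose h := d / (2 * (`|v| + `|w| + 1)).
have N0 : 0 < `|v| + `|w| + 1 by rewrite ltr_wpDl// addr_ge0.
have h0 : 0 < h by rewrite divr_gt0// mulr_gt0.
have Hb s t : 0 <= s <= h -> 0 <= t <= h -> ball x d (x + s *: v + t *: w).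
  move=> /andP[s0 sh] /andP[t0 th].
  rewrite -ball_normE /= -addrA opprD addrA subrr add0r normrN.
  apply: le_lt_trans (ler_normD _ _) _; rewrite !normrZ !ger0_norm//.
  apply: (@le_lt_trans _ _ (h * (`|v| + `|w| + 1))).
    rewrite -addrA mulrDr lerD// ?ler_wpM2r// ?mulrDr// ?lerDl.
    by apply: ler_wpDr; [rewrite mulr1 ltW|rewrite ler_wpM2r].
  rewrite /h invfM mulrA mulfVK ?gt_eqF// ltr_pdivrMr// mulr_natr.
  by rewrite mulr2n ltrDl.
have HU s t sh th := let: And3 H _ _ := Hd _ (Hb s t sh th) in H.
have [s [t [sh th E1]]] := second_difference h0 HU Cf.
have HU' s' t' : 0 <= s' <= h -> 0 <= t' <= h -> U (x + s' *: w + t' *: v).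
  by move=> s1 t1; rewrite addrAC; apply: HU.
have [s' [t' [sh' th' E2]]] := second_difference h0 HU' Cf.
have [_ A1 _] := Hd _ (Hb s t sh th).
have [_ _ B1] := Hd _ (Hb t' s' th' sh').
(* The second difference is symmetric in [v] and [w], so the two mixed derivatives agree at two
   possibly different points, each close enough to [x]. *)
have AB : A (x + s *: v + t *: w) = B (x + t' *: v + s' *: w).
  apply: (mulfI (lt0r_neq0 h0)); apply: (mulfI (lt0r_neq0 h0)).
  rewrite /A /B -E1 [x + t' *: v + _]addrAC -E2.
  by rewrite [x + h *: w + _]addrAC; lra.
rewrite AB in A1; rewrite (_ : _ - _ = A x - B (x + t' *: v + s' *: w) -
  (B x - B (x + t' *: v + s' *: w))); last by lra.
by apply: le_trans (ler_normB _ _) _; rewrite [e]splitr lerD// ltW.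
Qed.

End Schwarz.

Lemma cV_sum_delta (R : pzRingType) m (u : 'cV[R]_m) :
  u = \sum_i u i 0 *: delta_mx i 0.
Proof.
rewrite {1}(matrix_sum_delta u); apply: eq_bigr => i _.
by rewrite big_ord1.
Qed.

Lemma linear_sum_delta (R : pzRingType) m (W : lmodType R)
    (L : {linear 'cV[R]_m -> W}) (u : 'cV[R]_m) :
  L u = \sum_i u i 0 *: L (delta_mx i 0).
Proof.
by rewrite {1}(cV_sum_delta u) linear_sum; apply: eq_bigr => i _; rewrite linearZ.
Qed.

Section Components.
Variables (R : realType) (V : normedModType R) (m : nat).
Implicit Types (U : set V).

Lemma is_Ck_linear (W W' : normedModType R) k U (L : W -> W')
    (f : V -> W) : linear L -> continuous L -> open U ->
  is_Ck k U f -> is_Ck k U (fun x => L (f x)).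
Proof.
move=> linL.
pose lM := GRing.isLinear.Build _ _ _ _ _ linL.
pose L' : {linear _ -> _} := HB.pack L lM.
exact: (@is_Ck_lin _ _ _ _ k U L' f).
Qed.

Lemma is_Ck_coord k U (f : V -> 'cV[R]_m) i : open U ->
  is_Ck k U f -> is_Ck k U (fun x => f x i 0 : R^o).
Proof.
apply: (@is_Ck_linear _ R^o k U (fun v : 'cV[R]_m => v i 0)).
  by move=> a u v; rewrite !mxE.
exact: coord_continuous.
Qed.

Lemma is_Ck_col k U (f : V -> 'cV[R]_m) : open U ->
  (forall i, is_Ck k U (fun x => f x i 0 : R^o)) -> is_Ck k U f.
Proof.
move=> oU H.
rewrite (_ : f = fun x => \sum_i f x i 0 *: delta_mx i 0); last first.
  by apply/funext => x; exact: cV_sum_delta.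
apply: is_Ck_sum => // i.
apply: (@is_Ck_linear R^o _ k U (fun r : R^o => r *: delta_mx i 0) (fun x => f x i 0)) => //.
  by move=> a u v; rewrite scalerDl scalerA.
exact: scalel_continuous.
Qed.

Lemma is_CkZ k U (a : V -> R^o) (f : V -> 'cV[R]_m) : open U ->
  is_Ck k U a -> is_Ck k U f -> is_Ck k U (fun x => a x *: f x).
Proof.
move=> oU Ca Cf; apply: is_Ck_col => // i.
rewrite (_ : (fun x => _) = fun x => a x * f x i 0); last first.
  by apply/funext => x; rewrite mxE.
by apply: is_CkM => //; exact: is_Ck_coord.
Qed.

End Components.

(** * Differentials along variable directions, and composition *)

Section Composition.
Variables (R : realType) (V : normedModType R) (m : nat).
Implicit Types (U : set V).

(** [is_Ck] controls derivatives in fixed directions only, so the variable direction [Y x] is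
    expanded in the standard basis. *)
Lemma is_Ck_diff k (f : 'cV[R]_m -> R^o) (Y : 'cV[R]_m -> 'cV[R]_m) A : open A ->
  is_Ck k.+1 A f -> is_Ck k A Y -> is_Ck k A (fun x => 'd f x (Y x) : R^o).
Proof.
move=> oU [_ Cf] CY.
rewrite (_ : (fun x => _) = fun x => \sum_i Y x i 0 * 'd f x (delta_mx i 0)); last first.
  by apply/funext => x; rewrite linear_sum_delta.
apply: (@is_Ck_sum _ _ R^o) => // i; apply: is_CkM => //.
  exact: (is_Ck_coord i oU CY).
exact: Cf.
Qed.

Lemma is_Ck_diffv p k (f : 'cV[R]_m -> 'cV[R]_p) (Y : 'cV[R]_m -> 'cV[R]_m) A : open A ->
  is_Ck k.+1 A f -> is_Ck k A Y -> is_Ck k A (fun x => 'd f x (Y x)).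
Proof.
move=> oU [_ Cf] CY.
rewrite (_ : (fun x => _) = fun x => \sum_i Y x i 0 *: 'd f x (delta_mx i 0)); last first.
  by apply/funext => x; rewrite linear_sum_delta.
apply: is_Ck_sum => // i; apply: is_CkZ => //.
  exact: (is_Ck_coord i oU CY).
exact: Cf.
Qed.

Lemma is_Ck_comp k U (A : set 'cV[R]_m) (g : 'cV[R]_m -> R^o) (f : V -> 'cV[R]_m) :
  open U -> open A -> (forall x, U x -> A (f x)) ->
  is_Ck k A g -> is_Ck k U f -> is_Ck k U (fun x => g (f x) : R^o).
Proof.
move=> oU oA fUA; elim: k g => [|k IH] g.
  by move=> cg cf x Ux; apply: continuous_comp; [exact: cf|exact/cg/fUA].
move=> [dg Cg] Cf; have [df Hf] := Cf.
have D x (Ux : U x) := diff_comp (df x Ux) (dg _ (fUA x Ux)).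
split=> [x Ux|v]; first exact: differentiable_comp (df x Ux) (dg _ (fUA x Ux)).
pose h i x : R^o := 'd f x v i 0 * 'd g (f x) (delta_mx i 0).
apply: (@is_Ck_ext _ _ _ _ _ (fun x => \sum_i h i x)) => //.
  move=> x Ux; rewrite [RHS](congr1 (@^~ v) (D x Ux)) /=.
  by rewrite linear_sum_delta.
apply: (@is_Ck_sum _ _ R^o) => // i; apply: is_CkM => //.
  exact: (is_Ck_coord i oU (Hf v)).
exact: IH (Cg _) (is_CkS Cf).
Qed.

Lemma is_Ck_compv p k U (A : set 'cV[R]_m) (g : 'cV[R]_m -> 'cV[R]_p) (f : V -> 'cV[R]_m) :
  open U -> open A -> (forall x, U x -> A (f x)) ->
  is_Ck k A g -> is_Ck k U f -> is_Ck k U (fun x => g (f x)).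
Proof.
move=> oU oA fUA Cg Cf; apply: is_Ck_col => // i.
apply: (@is_Ck_comp k U A (fun y => g y i 0)) => //.
exact: (is_Ck_coord i oA Cg).
Qed.

End Composition.

Section SmoothOn.
Variables (R : realType) (V W : normedModType R).

Lemma smooth_on_differentiable (U : set V) (f : V -> W) x :
  smooth_on U f -> U x -> differentiable f x.
Proof. by move=> sf Ux; have [H _] := sf 1%N; exact: H. Qed.

Lemma smooth_on_sub (U U' : set V) (f : V -> W) :
  U' `<=` U -> smooth_on U f -> smooth_on U' f.
Proof. by move=> UU sf k; exact: (is_Ck_sub UU (sf k)). Qed.

Lemma smooth_on_ext (U : set V) (f g : V -> W) : open U ->
  (forall x, U x -> f x = g x) -> smooth_on U f -> smooth_on U g.
Proof. by move=> oU fg sf k; exact: (is_Ck_ext oU fg (sf k)). Qed.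

Lemma smooth_on_dir (U : set V) (f : V -> W) v :
  smooth_on U f -> smooth_on U (fun x => 'd f x v).
Proof. by move=> sf k; exact: (sf k.+1).2. Qed.

End SmoothOn.

(** * Charts and smooth fields *)

Lemma fun_app (A B : Type) (f g : A -> B) (a : A) : f = g -> f a = g a.
Proof. by move->. Qed.

Section Charts.
Variables (R : realType) (m : nat) (M : manifold R m).
Implicit Types (U : set M) (p q r x : M) (f : M -> R) (X Y : vector_field M).

Definition img U q : set 'cV[R]_m := fwd (at_ q) @` (U `&` dom (at_ q)).

Definition trans p q : 'cV[R]_m -> 'cV[R]_m := fwd (at_ q) \o bwd (at_ p).

(** Near a point of the image of the chart domain, membership in the image of [U] is the preimage of
    [U] under the continuous [bwd]. *)
Lemma open_imgI U q : open U -> open (img U q).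
Proof.
move=> oU; rewrite openE => y [x [Ux qx] <-].
have iy : (fwd (at_ q) @` dom (at_ q)) (fwd (at_ q) x) by exists x.
have nU : \forall z \near fwd (at_ q) x, U (bwd (at_ q) z).
  apply: (bwd_continuous iy); rewrite fwdK //.
  exact: open_nbhs_nbhs.
have nI := open_nbhs_nbhs (conj (@open_img _ _ _ (at_ q)) iy).
apply: filterS2 nU nI => z Uz [x' dx' zE]; exists x' => //; split=> //.
by rewrite -(fwdK dx') zE.
Qed.

Lemma img_mem U q x : U x -> dom (at_ q) x -> img U q (fwd (at_ q) x).
Proof. by move=> Ux qx; exists x. Qed.

Lemma img_sub U U' q : U `<=` U' -> img U q `<=` img U' q.
Proof. by move=> UU y [x [/UU Ux qx] <-]; exists x. Qed.

Lemma transE p q x : dom (at_ p) x -> trans p q (fwd (at_ p) x) = fwd (at_ q) x.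
Proof. by move=> px; rewrite /trans /= fwdK. Qed.

Lemma trans_img p q U y : U `<=` dom (at_ q) -> img U p y -> img U q (trans p q y).
Proof. by move=> Uq [x [Ux px] <-]; rewrite transE //; exists x => //; split=> //; exact: Uq. Qed.

Lemma trans_smooth p q U : U `<=` dom (at_ q) -> smooth_on (img U p) (trans p q).
Proof.
move=> Uq; apply: smooth_on_sub (at_compatible p q) => y [x [Ux px] <-].
by exists x => //; split=> //; exact: Uq.
Qed.

Lemma trans_differentiable p q x : dom (at_ p) x -> dom (at_ q) x ->
  differentiable (trans p q) (fwd (at_ p) x).
Proof.
move=> px qx; apply: (smooth_on_differentiable (at_compatible p q)).
by exists x.
Qed.

Lemma near_chart U q x : open U -> U x -> dom (at_ q) x ->
  \forall y \near fwd (at_ q) x, img U q y.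
Proof.
by move=> oU Ux qx; apply: open_nbhs_nbhs; split; [exact: open_imgI|exact: img_mem].
Qed.

Lemma tchangeD p q x u v : tchange p q x (u + v) = tchange p q x u + tchange p q x v.
Proof. exact: linearD. Qed.

Lemma tchangeZ p q x a u : tchange p q x (a *: u) = a *: tchange p q x u.
Proof. exact: linearZ. Qed.

Lemma tchange0 p q x : tchange p q x 0 = 0.
Proof. exact: linear0. Qed.

Lemma tchange_sum_delta p q x u :
  tchange p q x u = \sum_i u i 0 *: tchange p q x (delta_mx i 0).
Proof. exact: linear_sum_delta. Qed.

Lemma tchange_id p x v : dom (at_ p) x -> tchange p p x v = v.
Proof.
move=> px; rewrite /tchange.
have idE : \forall y \near fwd (at_ p) x, id y = trans p p y.
  apply: filterS (near_chart (@open_dom _ _ _ (at_ p)) px px) => y [z [_ pz] <-].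
  by rewrite transE.
by have [_ ->] := near_eq_diff idE (@ex_diff _ _ _ _ _ _ _ (is_diff_id _)); rewrite diff_val.
Qed.

Lemma tchange_comp p q r x v : dom (at_ p) x -> dom (at_ q) x -> dom (at_ r) x ->
  tchange q r x (tchange p q x v) = tchange p r x v.
Proof.
move=> px qx rx; rewrite /tchange -/(trans q r) -/(trans p q) -/(trans p r).
have D1 := trans_differentiable px qx.
have D2 : differentiable (trans q r) (trans p q (fwd (at_ p) x)).
  by rewrite (transE q px); exact: trans_differentiable.
have cE : \forall y \near fwd (at_ p) x, (trans q r \o trans p q) y = trans p r y.
  apply: filterS (near_chart (@open_dom _ _ _ (at_ q)) qx px) => y [z [qz pz] <-].
  by rewrite /= (transE q pz) (transE r qz) (transE r pz).
have [_ E2] := near_eq_diff cE (differentiable_comp D1 D2).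
have E1 := diff_comp D1 D2.
rewrite (transE q px) in E1.
have E3 := fun_app v E1; have E4 := fun_app v E2.
etransitivity; symmetry; [exact: E3|exact: E4].
Qed.

Lemma comp_in_change p q X x : dom (at_ p) x -> dom (at_ q) x ->
  comp_in q X x = tchange p q x (comp_in p X x).
Proof. by move=> px qx; rewrite /comp_in tchange_comp //; exact: at_dom. Qed.

Lemma comp_in_id X x : comp_in x X x = X x.
Proof. by rewrite /comp_in tchange_id //; exact: at_dom. Qed.

Lemma smooth_fun_sub U U' f : U' `<=` U -> smooth_fun U f -> smooth_fun U' f.
Proof. by move=> UU sf q; exact: (smooth_on_sub (img_sub UU) (sf q)). Qed.

Lemma smooth_vf_sub U U' X : U' `<=` U -> smooth_vf U X -> smooth_vf U' X.
Proof. by move=> UU sf q; exact: (smooth_on_sub (img_sub UU) (sf q)). Qed.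

Lemma smooth_fun_ext U f g : open U -> (forall x, U x -> f x = g x) ->
  smooth_fun U f -> smooth_fun U g.
Proof.
move=> oU fg sf q; apply: (smooth_on_ext (open_imgI oU)) (sf q).
by move=> y [x [Ux qx] <-]; rewrite /= fwdK //; exact: fg.
Qed.

Lemma smooth_vf_ext U X Y : open U -> (forall x, U x -> X x = Y x) ->
  smooth_vf U X -> smooth_vf U Y.
Proof.
move=> oU fg sf q; apply: (smooth_on_ext (open_imgI oU)) (sf q).
by move=> y [x [Ux qx] <-]; rewrite /= fwdK // /comp_in fg.
Qed.

Lemma smooth_fun_local U f :
  (forall x, U x -> exists2 U', U' x & smooth_fun U' f) -> smooth_fun U f.
Proof.
move=> H q k; apply: is_Ck_pt => y [x [Ux qx] <-].
have [U' U'x sf] := H x Ux; exists (img U' q); first exact: img_mem.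
exact: (sf q k).
Qed.

Lemma smooth_vf_local U X :
  (forall x, U x -> exists2 U', U' x & smooth_vf U' X) -> smooth_vf U X.
Proof.
move=> H q k; apply: is_Ck_pt => y [x [Ux qx] <-].
have [U' U'x sf] := H x Ux; exists (img U' q); first exact: img_mem.
exact: (sf q k).
Qed.

Lemma smooth_fun_chart p U f : open U -> U `<=` dom (at_ p) ->
  smooth_on (img U p) (f \o bwd (at_ p) : 'cV[R]_m -> R^o) -> smooth_fun U f.
Proof.
move=> oU Up sf q k.
have C : is_Ck k (img U q) (fun y => (f \o bwd (at_ p)) (trans q p y) : R^o).
  apply: (is_Ck_comp (open_imgI oU) (open_imgI oU)) (sf k) _.
    by move=> y; exact: trans_img.
  exact: trans_smooth.
apply: is_Ck_ext C; first exact: open_imgI.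
by move=> y [x [Ux qx] <-]; rewrite transE //= !fwdK //; exact: Up.
Qed.

(** The components in another chart are those in [p] pushed through the differential of the
    transition map, then read through the inverse transition: a variable vector in a variable
    differential, as in [is_Ck_diffv]. *)
Lemma smooth_vf_chart p U X : open U -> U `<=` dom (at_ p) ->
  smooth_on (img U p) (comp_in p X \o bwd (at_ p)) -> smooth_vf U X.
Proof.
move=> oU Up sX q.
apply: (smooth_on_ext (f := fun y => (fun z => 'd (trans p q) z
  ((comp_in p X \o bwd (at_ p)) z)) (trans q p y)) (open_imgI oU)).
  move=> y [x [Ux qx] <-]; have px := Up x Ux.
  by rewrite transE //= !fwdK // (comp_in_change X px qx).
move=> k.
have oUq : open (U `&` dom (at_ q)) by apply: openI => //; exact: open_dom.
have C : is_Ck k (img (U `&` dom (at_ q)) p)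
  (fun z => 'd (trans p q) z ((comp_in p X \o bwd (at_ p)) z)).
  apply: is_Ck_diffv; first exact: open_imgI.
    by apply: trans_smooth => z [].
  by apply: (smooth_on_sub _ sX) => y [z [[Uz _] pz] <-]; exists z.
apply: (is_Ck_compv (open_imgI oU) (open_imgI oUq)) C _.
  move=> y [x [Ux qx] <-]; rewrite transE //; exists x => //.
  by split=> //; exact: Up.
exact: trans_smooth.
Qed.

Lemma smooth_fun_continuous U f x : open U -> U x -> smooth_fun U f ->
  {for x, continuous f}.
Proof.
move=> oU Ux sf; have dx := at_dom x.
have c1 : {for fwd (at_ x) x, continuous (f \o bwd (at_ x))}.
  exact: (sf x 0%N _ (img_mem Ux dx)).
have c2 := continuous_comp (fwd_continuous dx) c1.
have E : ((f \o bwd (at_ x)) \o fwd (at_ x)) x = f x by rewrite /= fwdK.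
change (f @ x --> f x); rewrite -E.
apply: cvg_trans c2; apply: near_eq_cvg.
by apply: filterS (open_nbhs_nbhs (conj (@open_dom _ _ _ (at_ x)) dx)) => y dy /=; rewrite fwdK.
Qed.

End Charts.

(** * Smooth functions and fields, directional derivatives, and the bracket *)

Section FieldCalculus.
Variables (R : realType) (m : nat) (M : manifold R m).
Implicit Types (U : set M) (p q x : M) (f g h : M -> R) (X Y Z : vector_field M).

Lemma smooth_fun_cst U (c : R) : smooth_fun U (fun _ : M => c).
Proof. by move=> q k; exact: (is_Ck_cst k _ (c : R^o)). Qed.

Lemma smooth_funD U f g : open U -> smooth_fun U f -> smooth_fun U g ->
  smooth_fun U (fun x => f x + g x).
Proof. by move=> oU sf sg q k; exact: (is_CkD (open_imgI oU) (sf q k) (sg q k)). Qed.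

Lemma smooth_funM U f g : open U -> smooth_fun U f -> smooth_fun U g ->
  smooth_fun U (fun x => f x * g x).
Proof. by move=> oU sf sg q k; exact: (is_CkM (open_imgI oU) (sf q k) (sg q k)). Qed.

Lemma smooth_funN U f : open U -> smooth_fun U f -> smooth_fun U (fun x => - f x).
Proof.
move=> oU sf; apply: (smooth_fun_ext (f := fun x => -1 * f x)) => //.
  by move=> x _; rewrite mulN1r.
by apply: smooth_funM => //; exact: smooth_fun_cst.
Qed.

Lemma smooth_funB U f g : open U -> smooth_fun U f -> smooth_fun U g ->
  smooth_fun U (fun x => f x - g x).
Proof. by move=> oU sf sg; apply: smooth_funD => //; exact: smooth_funN. Qed.

Lemma smooth_fun_sum U (I : Type) (r : seq I) (P : pred I) (f : I -> M -> R) :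
  open U -> (forall i, smooth_fun U (f i)) ->
  smooth_fun U (fun x => \sum_(i <- r | P i) f i x).
Proof.
move=> oU sf; elim: r => [|i r IH].
  apply: (smooth_fun_ext (f := fun=> 0)) => // [x _|]; first by rewrite big_nil.
  exact: smooth_fun_cst.
apply: (smooth_fun_ext (f := fun x => (if P i then f i x else 0) +
    \sum_(j <- r | P j) f j x)) => // [x _|].
  by rewrite big_cons; case: (P i); rewrite // add0r.
by apply: smooth_funD => //; case: (P i) => //; exact: smooth_fun_cst.
Qed.

Lemma smooth_fun_prod U (I : Type) (r : seq I) (P : pred I) (f : I -> M -> R) :
  open U -> (forall i, smooth_fun U (f i)) ->
  smooth_fun U (fun x => \prod_(i <- r | P i) f i x).
Proof.
move=> oU sf; elim: r => [|i r IH].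
  apply: (smooth_fun_ext (f := fun=> 1)) => // [x _|]; first by rewrite big_nil.
  exact: smooth_fun_cst.
apply: (smooth_fun_ext (f := fun x => (if P i then f i x else 1) *
    \prod_(j <- r | P j) f j x)) => // [x _|].
  by rewrite big_cons; case: (P i); rewrite // mul1r.
by apply: smooth_funM => //; case: (P i) => //; exact: smooth_fun_cst.
Qed.

Lemma smooth_funV U f : open U -> (forall x, U x -> f x != 0) ->
  smooth_fun U f -> smooth_fun U (fun x => (f x)^-1).
Proof.
move=> oU f0 sf q k; apply: (is_CkV (open_imgI oU)) (sf q k).
by move=> y [x [Ux qx] <-]; rewrite /= fwdK //; exact: f0.
Qed.

Lemma comp_inD q X Y x :
  comp_in q (fun y => X y + Y y) x = comp_in q X x + comp_in q Y x.
Proof. exact: tchangeD. Qed.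

Lemma comp_inZ q f X x : comp_in q (fun y => f y *: X y) x = f x *: comp_in q X x.
Proof. exact: tchangeZ. Qed.

Lemma smooth_vf0 U : smooth_vf U (fun _ : M => 0 : 'cV[R]_m).
Proof.
move=> q k.
rewrite (_ : _ \o _ = fun=> 0); first exact: is_Ck_cst.
by apply/funext => y; rewrite /= /comp_in tchange0.
Qed.

Lemma smooth_vfD U X Y : open U -> smooth_vf U X -> smooth_vf U Y ->
  smooth_vf U (fun x => X x + Y x).
Proof.
move=> oU sX sY q k.
rewrite (_ : _ \o _ = fun y => (comp_in q X \o bwd (at_ q)) y +
  (comp_in q Y \o bwd (at_ q)) y).
  exact: (is_CkD (open_imgI oU) (sX q k) (sY q k)).
by apply/funext => y; rewrite /= comp_inD.
Qed.

Lemma smooth_vfZ U f X : open U -> smooth_fun U f -> smooth_vf U X ->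
  smooth_vf U (fun x => f x *: X x).
Proof.
move=> oU sf sX q k.
rewrite (_ : _ \o _ = fun y => (f \o bwd (at_ q)) y *:
  (comp_in q X \o bwd (at_ q)) y).
  exact: (is_CkZ (open_imgI oU) (sf q k) (sX q k)).
by apply/funext => y; rewrite /= comp_inZ.
Qed.

Lemma smooth_vfN U X : open U -> smooth_vf U X -> smooth_vf U (fun x => - X x).
Proof.
move=> oU sX; apply: (smooth_vf_ext (X := fun x => -1 *: X x)) => //.
  by move=> x _; rewrite scaleN1r.
by apply: smooth_vfZ => //; exact: smooth_fun_cst.
Qed.

Lemma smooth_vfB U X Y : open U -> smooth_vf U X -> smooth_vf U Y ->
  smooth_vf U (fun x => X x - Y x).
Proof. by move=> oU sX sY; apply: smooth_vfD => //; exact: smooth_vfN. Qed.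

Lemma smooth_vf_sum U (I : Type) (r : seq I) (X : I -> vector_field M) :
  open U -> (forall i, smooth_vf U (X i)) ->
  smooth_vf U (fun x => \sum_(i <- r) X i x).
Proof.
move=> oU sf; elim: r => [|i r IH].
  apply: (smooth_vf_ext (X := fun=> 0)) => // [x _|]; first by rewrite big_nil.
  exact: smooth_vf0.
apply: (smooth_vf_ext (X := fun x => X i x + \sum_(j <- r) X j x)) => // [x _|].
  by rewrite big_cons.
exact: smooth_vfD.
Qed.

Lemma fun_differentiable U f q x : open U -> smooth_fun U f -> U x -> dom (at_ q) x ->
  differentiable (f \o bwd (at_ q) : 'cV[R]_m -> R^o) (fwd (at_ q) x).
Proof.
move=> oU sf Ux qx; apply: (smooth_on_differentiable (sf q)); exact: img_mem.
Qed.

Lemma dfunDr f x u v : dfun f x (u + v) = dfun f x u + dfun f x v.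
Proof. exact: linearD. Qed.

Lemma dfunZr f x a u : dfun f x (a *: u) = a * dfun f x u.
Proof. exact: linearZ. Qed.

Lemma dfun0r f x : dfun f x 0 = 0.
Proof. exact: linear0. Qed.

Lemma dfunNr f x u : dfun f x (- u) = - dfun f x u.
Proof. exact: linearN. Qed.

Lemma dfunBr f x u v : dfun f x (u - v) = dfun f x u - dfun f x v.
Proof. by rewrite dfunDr dfunNr. Qed.

Lemma dfun_sumr f x u : dfun f x u = \sum_i u i 0 * dfun f x (delta_mx i 0).
Proof. exact: (linear_sum_delta _ u). Qed.

Lemma dfun_chart U f q x v : open U -> smooth_fun U f -> U x -> dom (at_ q) x ->
  dfun f x v = 'd (f \o bwd (at_ q) : 'cV[R]_m -> R^o) (fwd (at_ q) x) (tchange x q x v).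
Proof.
move=> oU sf Ux qx; have xx := at_dom x.
have D1 := trans_differentiable xx qx.
have D2 := fun_differentiable oU sf Ux qx.
rewrite -(transE q xx) in D2.
have nE : \forall y \near fwd (at_ x) x,
    ((f \o bwd (at_ q)) \o trans x q : _ -> R^o) y = (f \o bwd (at_ x)) y.
  apply: filterS (near_chart (@open_dom _ _ _ (at_ q)) qx xx) => y [z [qz xz] <-].
  by rewrite /= (transE q xz) !fwdK.
have [_ E2] := near_eq_diff nE (differentiable_comp D1 D2).
have E1 := diff_comp D1 D2.
rewrite (transE q xx) in E1.
have E3 := fun_app v E1; have E4 := fun_app v E2.
etransitivity; [exact: E4|exact: E3].
Qed.

Lemma dfun_ext U f g x v : open U -> smooth_fun U f -> U x ->
  (forall y, U y -> f y = g y) -> dfun f x v = dfun g x v.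
Proof.
move=> oU sf Ux fg.
have nE : \forall y \near fwd (at_ x) x,
    (f \o bwd (at_ x) : _ -> R^o) y = (g \o bwd (at_ x)) y.
  apply: filterS (near_chart oU Ux (at_dom x)) => y [z [Uz xz] <-].
  by rewrite /= fwdK // fg.
have [_ E] := near_eq_diff nE (fun_differentiable oU sf Ux (at_dom x)).
exact: esym (fun_app v E).
Qed.

Lemma dfun_cst (c : R) x v : dfun (fun _ : M => c) x v = 0.
Proof. exact: (fun_app v (diff_cst (c : R^o) _)). Qed.

Lemma dfunD U f g x v : open U -> smooth_fun U f -> smooth_fun U g -> U x ->
  dfun (fun y => f y + g y) x v = dfun f x v + dfun g x v.
Proof.
move=> oU sf sg Ux.
exact: (fun_app v (diffD (fun_differentiable oU sf Ux (at_dom x))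
                         (fun_differentiable oU sg Ux (at_dom x)))).
Qed.

Lemma dfunM U f g x v : open U -> smooth_fun U f -> smooth_fun U g -> U x ->
  dfun (fun y => f y * g y) x v = f x * dfun g x v + g x * dfun f x v.
Proof.
move=> oU sf sg Ux.
have := fun_app v (diffM (fun_differentiable oU sf Ux (at_dom x))
                         (fun_differentiable oU sg Ux (at_dom x))).
rewrite /= fwdK; last exact: at_dom.
by move=> E; exact: E.
Qed.

Lemma dfunN U f x v : open U -> smooth_fun U f -> U x ->
  dfun (fun y => - f y) x v = - dfun f x v.
Proof.
move=> oU sf Ux.
exact: (fun_app v (diffN (fun_differentiable oU sf Ux (at_dom x)))).
Qed.

Lemma dfunB U f g x v : open U -> smooth_fun U f -> smooth_fun U g -> U x ->
  dfun (fun y => f y - g y) x v = dfun f x v - dfun g x v.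
Proof.
move=> oU sf sg Ux; rewrite (@dfunD U f (fun y => - g y)) //; last exact: smooth_funN.
by rewrite (dfunN _ oU sg).
Qed.

Lemma dfun_sum U (I : Type) (r : seq I) (f : I -> M -> R) x v :
  open U -> (forall i, smooth_fun U (f i)) -> U x ->
  dfun (fun y => \sum_(i <- r) f i y) x v = \sum_(i <- r) dfun (f i) x v.
Proof.
move=> oU sf Ux; elim: r => [|i r IH].
  rewrite big_nil; apply: etrans (dfun_cst 0 x v); apply: (@dfun_ext U) => //.
    exact: (@smooth_fun_sum U _ _ _ f).
  by move=> y _; rewrite big_nil.
have sS : smooth_fun U (fun y => \sum_(j <- r) f j y) by exact: (@smooth_fun_sum U _ _ _ f).
rewrite big_cons -IH; apply: etrans (dfunD v oU (sf i) sS Ux).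
apply: (dfun_ext _ oU _ Ux); first exact: (@smooth_fun_sum U _ _ _ f).
by move=> y _; rewrite big_cons.
Qed.

Lemma dfun_smooth U f X : open U -> smooth_fun U f -> smooth_vf U X ->
  smooth_fun U (fun x => dfun f x (X x)).
Proof.
move=> oU sf sX q k; have oUq := open_imgI (q := q) oU.
apply: (is_Ck_ext oUq) (is_Ck_diff oUq (sf q k.+1) (sX q k)).
move=> y [x [Ux qx] <-] /=; rewrite fwdK // (dfun_chart _ oU sf Ux qx) //.
Qed.

Lemma extend_at p v : extend p v p = v.
Proof. by rewrite /extend tchange_id //; exact: at_dom. Qed.

Lemma comp_in_extend p v x : dom (at_ p) x -> comp_in p (extend p v) x = v.
Proof.
move=> px; rewrite /comp_in /extend tchange_comp //; last exact: at_dom.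
exact: tchange_id.
Qed.

Lemma extend_smooth p v : smooth_vf (dom (at_ p)) (extend p v).
Proof.
have op : open (dom (at_ p)) by exact: open_dom.
apply: (smooth_vf_chart (p := p)) => //.
apply: (smooth_on_ext (f := fun=> v)) => [|y [x [px _] <-]|k].
- exact: open_imgI.
- by rewrite /= fwdK // comp_in_extend.
- exact: is_Ck_cst.
Qed.

Lemma extend_comp_in p X x : dom (at_ p) x -> extend p (comp_in p X x) x = X x.
Proof.
by move=> px; rewrite /extend /comp_in tchange_comp ?tchange_id //; exact: at_dom.
Qed.

Lemma extend_sum_delta p u x :
  extend p u x = \sum_i u i 0 *: extend p (delta_mx i 0) x.
Proof. exact: tchange_sum_delta. Qed.

Lemma field_expand p X x : dom (at_ p) x ->
  X x = \sum_i comp_in p X x i 0 *: extend p (delta_mx i 0) x.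
Proof. by move=> px; rewrite -extend_sum_delta extend_comp_in. Qed.

Lemma comp_smooth U p X i : open U -> U `<=` dom (at_ p) -> smooth_vf U X ->
  smooth_fun U (fun x => comp_in p X x i 0).
Proof.
move=> oU Up sX; apply: (smooth_fun_chart oU Up) => k.
exact: (is_Ck_coord i (open_imgI oU) (sX p k)).
Qed.

Lemma diff_coord (V : normedModType R) (Y : V -> 'cV[R]_m) y u i :
  differentiable Y y -> 'd (fun z => Y z i 0 : R^o) y u = ('d Y y u) i 0.
Proof.
move=> dY.
have cl : linear (fun N : 'cV[R]_m => N i 0 : R^o) by move=> a v w; rewrite !mxE.
pose lM := GRing.isLinear.Build _ _ _ _ _ cl.
pose L : {linear 'cV[R]_m -> R^o} := HB.pack (fun N : 'cV[R]_m => N i 0 : R^o) lM.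
have cL : continuous L by exact: coord_continuous.
have E1 := fun_app u (diff_comp dY (differentiable_coord (Y y) i 0)).
have E2 := fun_app ('d Y y u) (diff_lin (Y y) cL).
etransitivity; [exact: E1|exact: E2].
Qed.

Lemma dfun_comp U Y x v i : open U -> U x -> smooth_vf U Y ->
  dfun (fun y => comp_in x Y y i 0) x v =
  ('d (comp_in x Y \o bwd (at_ x)) (fwd (at_ x) x) v) i 0.
Proof.
move=> oU Ux sY; apply: diff_coord.
apply: (smooth_on_differentiable (sY x)); apply: img_mem => //; exact: at_dom.
Qed.

(** Fields with constant components turn iterated directional derivatives into second derivatives in
    the chart, to which Schwarz's theorem applies. *)
Lemma dfun_extend U f x u v : open U -> U x -> smooth_fun U f ->
  dfun (fun y => dfun f y (extend x u y)) x v =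
  'd (fun z => 'd (f \o bwd (at_ x) : 'cV[R]_m -> R^o) z u : R^o) (fwd (at_ x) x) v.
Proof.
move=> oU Ux sf; have xx := at_dom x.
have nE : \forall z \near fwd (at_ x) x,
    'd (f \o bwd (at_ x) : 'cV[R]_m -> R^o) z u =
    (((fun y => dfun f y (extend x u y)) \o bwd (at_ x)) z : R^o).
  apply: filterS (near_chart oU Ux xx) => z [y [Uy xy] <-].
  rewrite /= fwdK // (dfun_chart _ oU sf Uy xy).
  by rewrite -/(comp_in x (extend x u) y) comp_in_extend.
have dF : differentiable (fun z => 'd (f \o bwd (at_ x) : 'cV[R]_m -> R^o) z u : R^o)
    (fwd (at_ x) x).
  apply: (smooth_on_differentiable (smooth_on_dir u (sf x))).
  exact: img_mem.
have [_ E] := near_eq_diff nE dF.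
exact: (fun_app v E).
Qed.

Lemma dfun_extendC U f x u v : open U -> U x -> smooth_fun U f ->
  dfun (fun y => dfun f y (extend x u y)) x v =
  dfun (fun y => dfun f y (extend x v y)) x u.
Proof.
move=> oU Ux sf; rewrite (dfun_extend _ _ oU Ux sf) (dfun_extend _ _ oU Ux sf).
apply: (schwarz (U := img U x)); first exact: open_imgI.
  by apply: img_mem => //; exact: at_dom.
exact: sf.
Qed.

(** The Leibniz rule in the coordinate frame is applied to [X] and to the field with constant
    components [X x]; they differ by the terms where [v] differentiates the components. *)
Lemma dfun_dfun U f X x v : open U -> U x -> smooth_fun U f -> smooth_vf U X ->
  dfun (fun y => dfun f y (X y)) x v =
  dfun f x ('d (comp_in x X \o bwd (at_ x)) (fwd (at_ x) x) v) +
  dfun (fun y => dfun f y (extend x (X x) y)) x v.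
Proof.
move=> oU Ux sf sX; have xx := at_dom x.
set D := 'd (comp_in x X \o bwd (at_ x)) (fwd (at_ x) x).
pose U' := U `&` dom (at_ x).
have oU' : open U' by apply: openI => //; exact: open_dom.
have sf' : smooth_fun U' f by apply: smooth_fun_sub sf => y [].
have sX' : smooth_vf U' X by apply: smooth_vf_sub sX => y [].
have sE i : smooth_fun U' (fun y => dfun f y (extend x (delta_mx i 0) y)).
  by apply: dfun_smooth => //; apply: smooth_vf_sub (extend_smooth x _) => y [].
have sC i : smooth_fun U' (fun y => comp_in x X y i 0).
  by apply: comp_smooth => // y [].
pose F c i y := c i y * dfun f y (extend x (delta_mx i 0) y).
have sF c i : smooth_fun U' (c i) -> smooth_fun U' (F c i).
  by move=> sc; apply: smooth_funM.
have key c (Y : vector_field M) : (forall i, smooth_fun U' (c i)) -> smooth_vf U' Y ->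
   (forall y, U' y -> Y y = \sum_i c i y *: extend x (delta_mx i 0) y) ->
   dfun (fun y => dfun f y (Y y)) x v = \sum_i (c i x *
     dfun (fun y => dfun f y (extend x (delta_mx i 0) y)) x v +
     dfun f x (delta_mx i 0) * dfun (c i) x v).
  move=> sc sY YE; have U'x : U' x by [].
  rewrite (dfun_ext (U := U') (g := fun y => \sum_i F c i y)) //.
  - rewrite (@dfun_sum U' _ _ (F c) x v oU') // => [|i]; last exact: sF.
    apply: eq_bigr => i _; rewrite (dfunM v oU' (sc i) (sE i) U'x).
    by rewrite extend_at.
  - exact: dfun_smooth.
  - move=> y Uy; rewrite (YE y Uy) /F; elim/big_rec2: _ => [|i a b _ <-].
      by rewrite dfun0r.
    by rewrite dfunDr dfunZr.
rewrite (key (fun i y => comp_in x X y i 0) X) //; last by move=> y [_ xy]; exact: field_expand.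
rewrite (key (fun i _ => X x i 0) (extend x (X x))); first last.
- by move=> y _; exact: extend_sum_delta.
- by apply: smooth_vf_sub (extend_smooth x _) => y [].
- by move=> i; exact: smooth_fun_cst.
rewrite [dfun f x _]dfun_sumr -big_split /=; apply: eq_bigr => i _.
rewrite comp_in_id (dfun_comp v i oU Ux sX) -/D dfun_cst mulr0 addr0.
by rewrite addrC [_ * (D v i 0)]mulrC.
Qed.

(** The second-order terms of [dfun_dfun] are symmetric by [dfun_extendC] and cancel, leaving the
    coordinate formula of the bracket. *)
Lemma bracket_dfun U f X Y x : open U -> U x ->
  smooth_fun U f -> smooth_vf U X -> smooth_vf U Y ->
  dfun f x (bracket X Y x) =
  dfun (fun y => dfun f y (Y y)) x (X x) - dfun (fun y => dfun f y (X y)) x (Y x).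
Proof.
move=> oU Ux sf sX sY.
rewrite (dfun_dfun _ oU Ux sf sX) (dfun_dfun _ oU Ux sf sY) /bracket dfunBr.
by have := dfun_extendC (X x) (Y x) oU Ux sf; rewrite /bracket; lra.
Qed.

(** The coordinate functions of the chart suffice. This reduces the Jacobi identity to a computation
    with iterated derivatives of functions. *)
Lemma dfun_separates x u v :
  (forall U f, open U -> U x -> smooth_fun U f -> dfun f x u = dfun f x v) -> u = v.
Proof.
move=> H; have xx := at_dom x.
have ox : open (dom (at_ x)) by exact: open_dom.
have iE : \forall y \near fwd (at_ x) x, id y = (fwd (at_ x) \o bwd (at_ x)) y.
  by apply: filterS (near_chart ox xx xx) => y [z [_ xz] <-]; rewrite /= fwdK.
have [dT ET] := near_eq_diff iE (@ex_diff _ _ _ _ _ _ _ (is_diff_id _)).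
have E w i : dfun (fun y => fwd (at_ x) y i 0) x w = w i 0.
  rewrite /dfun (diff_coord w i dT); congr (fun_of_matrix _ i 0).
  have E1 := fun_app w ET.
  have E2 := fun_app w (@diff_val _ _ _ _ _ _ _ (is_diff_id (fwd (at_ x) x))).
  by etransitivity; [exact: E1|exact: E2].
apply/matrixP => i j; rewrite ord1.
rewrite -[LHS](E u i) -[RHS](E v i).
apply: (H (dom (at_ x))); [exact: ox|exact: xx|].
apply: (smooth_fun_chart (p := x) ox) => [//|k].
apply: (is_Ck_ext (f := fun y : 'cV[R]_m => y i 0 : R^o) (open_imgI ox)).
  by move=> y [z [_ xz] <-]; rewrite /= fwdK.
apply: (is_Ck_coord (f := id)); first exact: open_imgI.
case: k => [|k] /=; first by move=> y _; exact: cvg_id.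
split=> [y _|w]; first exact: ex_diff.
apply: (is_Ck_ext (f := fun=> w) (open_imgI ox)); last exact: is_Ck_cst.
by move=> y _; rewrite diff_val.
Qed.

End FieldCalculus.

(** * Connections and curvature *)

Section Connection.
Variables (R : realType) (m : nat) (M : manifold R m).
Variable nabla : M -> 'cV[R]_m -> vector_field M -> 'cV[R]_m.
Hypothesis nabla_conn : affine_connection nabla.
Implicit Types (U : set M) (p q x : M) (f h : M -> R) (X Y Z : vector_field M).

Lemma nablaDl U Y x u v : open U -> smooth_vf U Y -> U x ->
  nabla x (u + v) Y = nabla x u Y + nabla x v Y.
Proof.
by move=> oU sY Ux; have := conn_linear nabla_conn oU sY Ux 1 u v; rewrite !scale1r.
Qed.

Lemma nabla0l U Y x : open U -> smooth_vf U Y -> U x -> nabla x 0 Y = 0.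
Proof.
move=> oU sY Ux; have := nablaDl 0 0 oU sY Ux.
by rewrite addr0 => /(congr1 (fun w => w - nabla x 0 Y)); rewrite subrr addrK.
Qed.

Lemma nablaZl U Y x a u : open U -> smooth_vf U Y -> U x ->
  nabla x (a *: u) Y = a *: nabla x u Y.
Proof.
move=> oU sY Ux; have := conn_linear nabla_conn oU sY Ux a u 0.
by rewrite (nabla0l oU sY Ux) !addr0.
Qed.

Lemma nablaNl U Y x u : open U -> smooth_vf U Y -> U x ->
  nabla x (- u) Y = - nabla x u Y.
Proof. by move=> oU sY Ux; rewrite -scaleN1r (nablaZl _ _ oU sY Ux) scaleN1r. Qed.

Lemma nablaBl U Y x u v : open U -> smooth_vf U Y -> U x ->
  nabla x (u - v) Y = nabla x u Y - nabla x v Y.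
Proof. by move=> oU sY Ux; rewrite (nablaDl _ _ oU sY Ux) (nablaNl _ oU sY Ux). Qed.

Lemma nablaD U Y Z x u : open U -> smooth_vf U Y -> smooth_vf U Z -> U x ->
  nabla x u (fun y => Y y + Z y) = nabla x u Y + nabla x u Z.
Proof. by move=> oU sY sZ Ux; exact: (conn_additive nabla_conn oU sY sZ Ux u). Qed.

Lemma nablaZ U f Y x u : open U -> smooth_fun U f -> smooth_vf U Y -> U x ->
  nabla x u (fun y => f y *: Y y) = dfun f x u *: Y x + f x *: nabla x u Y.
Proof. by move=> oU sf sY Ux; exact: (conn_leibniz nabla_conn oU sf sY Ux u). Qed.

Lemma nablaZc U a Y x u : open U -> smooth_vf U Y -> U x ->
  nabla x u (fun y => a *: Y y) = a *: nabla x u Y.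
Proof.
move=> oU sY Ux; rewrite (nablaZ u oU (@smooth_fun_cst _ _ _ U a) sY Ux).
by rewrite dfun_cst scale0r add0r.
Qed.

Lemma nablaN U Y x u : open U -> smooth_vf U Y -> U x ->
  nabla x u (fun y => - Y y) = - nabla x u Y.
Proof.
move=> oU sY Ux; rewrite -scaleN1r -(nablaZc (-1) u oU sY Ux).
by congr (nabla x u _); apply/funext => y; rewrite scaleN1r.
Qed.

Lemma nablaB U Y Z x u : open U -> smooth_vf U Y -> smooth_vf U Z -> U x ->
  nabla x u (fun y => Y y - Z y) = nabla x u Y - nabla x u Z.
Proof.
move=> oU sY sZ Ux; rewrite (@nablaD U Y (fun y => - Z y)) //; last exact: smooth_vfN.
by rewrite (nablaN u oU sZ Ux).
Qed.

(* Y - Z is equal to 1_(~` U) (Y - Z), and 1_(~` U) vanishes on U, hence is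
   smooth there. *)
Lemma nabla_local U Y Z x u : open U -> smooth_vf U Y -> U x ->
  (forall y, U y -> Y y = Z y) -> nabla x u Y = nabla x u Z.
Proof.
move=> oU sY Ux YZ; have sZ := smooth_vf_ext oU YZ sY.
pose h (y : M) : R := (~~ `[< U y >])%:R.
have h0 y : U y -> h y = 0 by move=> Uy; rewrite /h asboolT.
have sh : smooth_fun U h.
  apply: (smooth_fun_ext oU _ (@smooth_fun_cst _ _ _ U 0)) => y Uy.
  by rewrite h0.
have sW := smooth_vfB oU sY sZ.
apply/eqP; rewrite -subr_eq0 -(nablaB u oU sY sZ Ux); apply/eqP.
rewrite (_ : (fun y => Y y - Z y) = (fun y => h y *: (Y y - Z y))).
  by rewrite (nablaZ u oU sh sW Ux) (h0 x Ux) scale0r addr0 YZ // subrr scaler0.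
apply/funext => y; rewrite /h; case: asboolP => [Uy|_]; last by rewrite scale1r.
by rewrite YZ // subrr scaler0.
Qed.

Lemma cov_smooth U X Y : open U -> smooth_vf U X -> smooth_vf U Y ->
  smooth_vf U (cov nabla X Y).
Proof. exact: (conn_smooth nabla_conn). Qed.

Lemma nabla_smooth U X Y : open U -> smooth_vf U X -> smooth_vf U Y ->
  smooth_vf U (fun x => nabla x (X x) Y).
Proof. exact: (conn_smooth nabla_conn). Qed.

Lemma nabla_sum U (I : Type) (r : seq I) (X : I -> vector_field M) x u :
  open U -> (forall i, smooth_vf U (X i)) -> U x ->
  nabla x u (fun y => \sum_(i <- r) X i y) = \sum_(i <- r) nabla x u (X i).
Proof.
move=> oU sX Ux; elim: r => [|i r IH].
  have := nablaZc 0 u oU (@smooth_vf0 _ _ M U) Ux; rewrite !scale0r big_nil => E.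
  by apply: etrans E; congr (nabla x u _); apply/funext => y; rewrite big_nil.
rewrite big_cons -IH -(nablaD u oU (sX i) _ Ux); last exact: smooth_vf_sum.
by congr (nabla x u _); apply/funext => y; rewrite big_cons.
Qed.

Hypothesis torsion_free : forall U X Y, open U -> smooth_vf U X -> smooth_vf U Y ->
  forall x, U x -> cov nabla X Y x - cov nabla Y X x = bracket X Y x.

(** Smoothness, locality, additivity and the Leibniz rule of the bracket are read off from this
    formula rather than from coordinates. *)
Lemma bracketE U X Y x : open U -> smooth_vf U X -> smooth_vf U Y -> U x ->
  bracket X Y x = nabla x (X x) Y - nabla x (Y x) X.
Proof. by move=> oU sX sY Ux; rewrite -(torsion_free oU sX sY Ux). Qed.

Lemma bracket_smooth U X Y : open U -> smooth_vf U X -> smooth_vf U Y ->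
  smooth_vf U (bracket X Y).
Proof.
move=> oU sX sY.
apply: (smooth_vf_ext (X := fun x => nabla x (X x) Y - nabla x (Y x) X)) => //.
  by move=> x Ux; rewrite (bracketE oU sX sY Ux).
by apply: smooth_vfB => //; exact: nabla_smooth.
Qed.

Lemma bracketC X Y x : bracket X Y x = - bracket Y X x.
Proof. by rewrite /bracket opprB. Qed.

Lemma bracket_ext U X X' Y Y' x : open U -> smooth_vf U X -> smooth_vf U Y -> U x ->
  (forall y, U y -> X y = X' y) -> (forall y, U y -> Y y = Y' y) ->
  bracket X Y x = bracket X' Y' x.
Proof.
move=> oU sX sY Ux XX YY.
have sX' := smooth_vf_ext oU XX sX; have sY' := smooth_vf_ext oU YY sY.
rewrite (bracketE oU sX sY Ux) (bracketE oU sX' sY' Ux) -XX // -YY //.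
by rewrite (nabla_local (X x) oU sY Ux YY) (nabla_local (Y x) oU sX Ux XX).
Qed.

Lemma bracketDl U X X' Y x : open U -> smooth_vf U X -> smooth_vf U X' ->
  smooth_vf U Y -> U x ->
  bracket (fun y => X y + X' y) Y x = bracket X Y x + bracket X' Y x.
Proof.
move=> oU sX sX' sY Ux; have sXX := smooth_vfD oU sX sX'.
rewrite (bracketE oU sXX sY Ux) (bracketE oU sX sY Ux) (bracketE oU sX' sY Ux).
by rewrite (nablaDl _ _ oU sY Ux) (nablaD _ oU sX sX' Ux) opprD addrACA.
Qed.

Lemma bracketZl U f X Y x : open U -> smooth_fun U f -> smooth_vf U X ->
  smooth_vf U Y -> U x ->
  bracket (fun y => f y *: X y) Y x = f x *: bracket X Y x - dfun f x (Y x) *: X x.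
Proof.
move=> oU sf sX sY Ux; have sfX := smooth_vfZ oU sf sX.
rewrite (bracketE oU sfX sY Ux) (bracketE oU sX sY Ux).
rewrite (nablaZl _ _ oU sY Ux) (nablaZ _ oU sf sX Ux) scalerBr opprD.
by rewrite addrA addrAC.
Qed.

Lemma jacobi U X Y Z x : open U -> smooth_vf U X -> smooth_vf U Y ->
  smooth_vf U Z -> U x ->
  bracket X (bracket Y Z) x + bracket Y (bracket Z X) x +
  bracket Z (bracket X Y) x = 0.
Proof.
move=> oU sX sY sZ Ux; apply: (@dfun_separates _ _ _ x) => V f oV Vx sf.
pose W := U `&` V; have oW : open W by exact: openI.
have Wx : W x by split.
have {}sf : smooth_fun W f by apply: (smooth_fun_sub _ sf) => y [].
have {}sX : smooth_vf W X by apply: (smooth_vf_sub _ sX) => y [].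
have {}sY : smooth_vf W Y by apply: (smooth_vf_sub _ sY) => y [].
have {}sZ : smooth_vf W Z by apply: (smooth_vf_sub _ sZ) => y [].
(* [T A B C] is A(B(C f)) at [x], hidden by the existential so that [ring] meets atoms only. The
   twelve terms of the cyclic sum cancel in pairs. *)
have [T key] : exists T : vector_field M -> vector_field M -> vector_field M -> R,
  forall A B C, smooth_vf W A -> smooth_vf W B -> smooth_vf W C ->
  dfun f x (bracket A (bracket B C) x) = T A B C - T A C B - (T B C A - T C B A).
  exists (fun A B C => dfun (fun y => dfun (fun z => dfun f z (C z)) y (B y)) x (A x)).
  move=> A B C.
  move=> sA sB sC; have sBC := bracket_smooth oW sB sC.
  have sd D : smooth_vf W D -> smooth_fun W (fun z => dfun f z (D z)).
    by move=> sD; exact: dfun_smooth.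
  have sdd D E : smooth_vf W D -> smooth_vf W E ->
      smooth_fun W (fun y => dfun (fun z => dfun f z (D z)) y (E y)).
    by move=> sD sE; apply: dfun_smooth => //; exact: sd.
  rewrite (bracket_dfun oW Wx sf sA sBC) (bracket_dfun oW Wx (sd A sA) sB sC).
  congr (_ - _); apply: etrans _ (dfunB _ oW (sdd C B sC sB) (sdd B C sB sC) Wx).
  apply: (dfun_ext _ oW (sd _ sBC) Wx) => y Wy.
  by rewrite (bracket_dfun oW Wy sf sB sC).
rewrite (dfunDr f x (_ + bracket Y (bracket Z X) x)).
rewrite (dfunDr f x (bracket X (bracket Y Z) x)) (key X Y Z sX sY sZ).
rewrite (key Y Z X sY sZ sX) (key Z X Y sZ sX sY).
by rewrite dfun0r; ring.
Qed.

End Connection.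

(* Generalizing the geometric terms keeps [ring] from comparing them up to
   conversion, which is intractable. *)
Ltac vgen :=
  repeat match goal with
  | |- context [bil_at ?g ?x ?u ?v] => generalize (bil_at g x u v); intro
  | |- context [form_at ?e ?x ?u] => generalize (form_at e x u); intro
  | |- context [dfun ?f ?x ?v] => generalize (dfun f x v); intro
  end;
  repeat match goal with
  | |- context [@mulmx ?S ?m ?n ?p ?A ?v] => generalize (@mulmx S m n p A v); intro
  end;
  repeat match goal with
  | |- context [curvature_at ?n ?x ?u ?v ?w] =>
      generalize (curvature_at n x u v w); intro
  end;
  repeat match goal with
  | |- context [cov ?n ?X ?Y ?x] => generalize (cov n X Y x); intro
  | |- context [curvature ?n ?X ?Y ?Z ?x] => generalize (curvature n X Y Z x); intro
  end.

Ltac vring := vgen; apply/matrixP => ? ?; rewrite !mxE; ring.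

(** Lets the three summands of [curvature] be replaced at once by their expansions. *)
Lemma sub3 (V : zmodType) (a a' b b' c c' : V) :
  a = a' -> b = b' -> c = c' -> a - b - c = a' - b' - c'.
Proof. by move=> -> -> ->. Qed.

(** * Linearity of the curvature over functions *)

Section Curvature.
Variables (R : realType) (m : nat) (M : manifold R m).
Variable nabla : M -> 'cV[R]_m -> vector_field M -> 'cV[R]_m.
Hypothesis nabla_conn : affine_connection nabla.
Hypothesis torsion_free : forall U (X Y : vector_field M),
  open U -> smooth_vf U X -> smooth_vf U Y ->
  forall x, U x -> cov nabla X Y x - cov nabla Y X x = bracket X Y x.
Implicit Types (U : set M) (p q x : M) (f h : M -> R) (X Y Z : vector_field M).

Lemma curvature_smooth U X Y Z : open U -> smooth_vf U X -> smooth_vf U Y ->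
  smooth_vf U Z -> smooth_vf U (curvature nabla X Y Z).
Proof.
move=> oU sX sY sZ; have sB := bracket_smooth nabla_conn torsion_free oU sX sY.
apply: smooth_vfB => //; last exact: (cov_smooth nabla_conn oU sB sZ).
have sYZ := cov_smooth nabla_conn oU sY sZ.
have sXZ := cov_smooth nabla_conn oU sX sZ.
apply: smooth_vfB => //.
  exact: (cov_smooth nabla_conn oU sX sYZ).
exact: (cov_smooth nabla_conn oU sY sXZ).
Qed.

Lemma curvature_ext U X X' Y Y' Z Z' x : open U -> U x ->
  smooth_vf U X -> smooth_vf U Y -> smooth_vf U Z ->
  (forall y, U y -> X y = X' y) -> (forall y, U y -> Y y = Y' y) ->
  (forall y, U y -> Z y = Z' y) ->
  curvature nabla X Y Z x = curvature nabla X' Y' Z' x.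
Proof.
move=> oU Ux sX sY sZ XX YY ZZ; rewrite /curvature.
have E A A' : smooth_vf U A -> (forall y, U y -> A y = A' y) ->
    forall y, U y -> cov nabla A Z y = cov nabla A' Z' y.
  move=> sA AA y Uy; rewrite /cov (AA y Uy).
  exact: (nabla_local nabla_conn _ oU sZ Uy ZZ).
have E2 A A' u : smooth_vf U A -> (forall y, U y -> A y = A' y) ->
    nabla x u (cov nabla A Z) = nabla x u (cov nabla A' Z').
  move=> sA AA; apply: (nabla_local nabla_conn u oU _ Ux (E A A' sA AA)).
  exact: cov_smooth.
congr (_ - _ - _); rewrite /cov -?XX -?YY //; [exact: E2|exact: E2|].
rewrite (bracket_ext nabla_conn torsion_free oU sX sY Ux XX YY).
exact: (nabla_local nabla_conn _ oU sZ Ux ZZ).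
Qed.

Lemma curvature_skew U X Y Z x : open U -> U x ->
  smooth_vf U X -> smooth_vf U Y -> smooth_vf U Z ->
  curvature nabla X Y Z x = - curvature nabla Y X Z x.
Proof.
move=> oU Ux sX sY sZ; rewrite /curvature.
rewrite [cov nabla (bracket X Y) Z x]/cov bracketC (nablaNl nabla_conn _ oU sZ Ux).
by rewrite -/(cov nabla (bracket Y X) Z x) !opprB opprK addrC addrA.
Qed.

Lemma curvatureD1 U X X' Y Z x : open U -> U x ->
  smooth_vf U X -> smooth_vf U X' -> smooth_vf U Y -> smooth_vf U Z ->
  curvature nabla (fun y => X y + X' y) Y Z x =
  curvature nabla X Y Z x + curvature nabla X' Y Z x.
Proof.
move=> oU Ux sX sX' sY sZ; rewrite /curvature.
have sXZ := cov_smooth nabla_conn oU sX sZ.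
have sX'Z := cov_smooth nabla_conn oU sX' sZ.
have sYZ := cov_smooth nabla_conn oU sY sZ.
have E1 : cov nabla Y (cov nabla (fun y => X y + X' y) Z) x =
  cov nabla Y (cov nabla X Z) x + cov nabla Y (cov nabla X' Z) x.
  rewrite -[RHS](nablaD nabla_conn _ oU sXZ sX'Z Ux).
  apply: (nabla_local nabla_conn _ oU _ Ux) => [|y Uy].
    by apply: cov_smooth => //; exact: smooth_vfD.
  exact: (nablaDl nabla_conn _ _ oU sZ Uy).
have E2 : cov nabla (bracket (fun y => X y + X' y) Y) Z x =
    cov nabla (bracket X Y) Z x + cov nabla (bracket X' Y) Z x.
  rewrite {1}/cov (bracketDl nabla_conn torsion_free oU sX sX' sY Ux).
  exact: (nablaDl nabla_conn _ _ oU sZ Ux).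
have E3 : cov nabla (fun y => X y + X' y) (cov nabla Y Z) x =
    cov nabla X (cov nabla Y Z) x + cov nabla X' (cov nabla Y Z) x.
  exact: (nablaDl nabla_conn _ _ oU sYZ Ux).
apply: etrans (sub3 E3 E1 E2) _.
vring.
Qed.

(** The derivative of [f] along [Y] appears in nabla_Y nabla_{fX} Z and, with the opposite sign, in
    nabla_{[fX, Y]} Z. *)
Lemma curvatureZ1 U f X Y Z x : open U -> U x -> smooth_fun U f ->
  smooth_vf U X -> smooth_vf U Y -> smooth_vf U Z ->
  curvature nabla (fun y => f y *: X y) Y Z x = f x *: curvature nabla X Y Z x.
Proof.
move=> oU Ux sf sX sY sZ; rewrite /curvature.
have sXZ := cov_smooth nabla_conn oU sX sZ.
have sYZ := cov_smooth nabla_conn oU sY sZ.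
have E1 : cov nabla Y (cov nabla (fun y => f y *: X y) Z) x =
  dfun f x (Y x) *: cov nabla X Z x + f x *: cov nabla Y (cov nabla X Z) x.
  rewrite -[RHS](nablaZ nabla_conn _ oU sf sXZ Ux).
  apply: (nabla_local nabla_conn _ oU _ Ux) => [|y Uy].
    by apply: cov_smooth => //; exact: smooth_vfZ.
  exact: (nablaZl nabla_conn _ _ oU sZ Uy).
have E2 : cov nabla (bracket (fun y => f y *: X y) Y) Z x =
    f x *: cov nabla (bracket X Y) Z x - dfun f x (Y x) *: cov nabla X Z x.
  rewrite {1}/cov (bracketZl nabla_conn torsion_free oU sf sX sY Ux).
  by rewrite (nablaBl nabla_conn _ _ oU sZ Ux) !(nablaZl nabla_conn _ _ oU sZ Ux).
have E3 : cov nabla (fun y => f y *: X y) (cov nabla Y Z) x =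
    f x *: cov nabla X (cov nabla Y Z) x.
  exact: (nablaZl nabla_conn _ _ oU sYZ Ux).
apply: etrans (sub3 E3 E1 E2) _.
vring.
Qed.

Lemma curvatureD3 U X Y Z Z' x : open U -> U x ->
  smooth_vf U X -> smooth_vf U Y -> smooth_vf U Z -> smooth_vf U Z' ->
  curvature nabla X Y (fun y => Z y + Z' y) x =
  curvature nabla X Y Z x + curvature nabla X Y Z' x.
Proof.
move=> oU Ux sX sY sZ sZ'; rewrite /curvature.
have E1 A B : smooth_vf U A -> smooth_vf U B ->
    cov nabla A (cov nabla B (fun y => Z y + Z' y)) x =
    cov nabla A (cov nabla B Z) x + cov nabla A (cov nabla B Z') x.
  move=> sA sB; have sBZ := cov_smooth nabla_conn oU sB sZ.
  have sBZ' := cov_smooth nabla_conn oU sB sZ'.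
  rewrite -[RHS](nablaD nabla_conn _ oU sBZ sBZ' Ux).
  apply: (nabla_local nabla_conn _ oU _ Ux) => [|y Uy].
    by apply: cov_smooth => //; exact: smooth_vfD.
  exact: (nablaD nabla_conn _ oU sZ sZ' Uy).
have E2 : cov nabla (bracket X Y) (fun y => Z y + Z' y) x =
    cov nabla (bracket X Y) Z x + cov nabla (bracket X Y) Z' x.
  exact: (nablaD nabla_conn _ oU sZ sZ' Ux).
apply: etrans (sub3 (E1 X Y sX sY) (E1 Y X sY sX) E2) _.
vring.
Qed.

(** First derivatives of [f] cancel in the commutator; the second derivatives X(Y f) - Y(X f) are
    offset by the derivative of [f] along the bracket. *)
Lemma curvatureZ3 U f X Y Z x : open U -> U x -> smooth_fun U f ->
  smooth_vf U X -> smooth_vf U Y -> smooth_vf U Z ->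
  curvature nabla X Y (fun y => f y *: Z y) x = f x *: curvature nabla X Y Z x.
Proof.
move=> oU Ux sf sX sY sZ; rewrite /curvature.
have E1 A B : smooth_vf U A -> smooth_vf U B ->
    cov nabla A (cov nabla B (fun y => f y *: Z y)) x =
    (dfun (fun y => dfun f y (B y)) x (A x) *: Z x
     + dfun f x (B x) *: cov nabla A Z x)
    + (dfun f x (A x) *: cov nabla B Z x + f x *: cov nabla A (cov nabla B Z) x).
  move=> sA sB; have sBZ := cov_smooth nabla_conn oU sB sZ.
  have sBf := dfun_smooth oU sf sB.
  rewrite -[X in X + _](nablaZ nabla_conn _ oU sBf sZ Ux).
  rewrite -[X in _ + X](nablaZ nabla_conn _ oU sf sBZ Ux).
  rewrite -[RHS](nablaD nabla_conn (A x) oU _ _ Ux); try by apply: smooth_vfZ.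
  apply: (nabla_local nabla_conn _ oU _ Ux) => [|y Uy].
    by apply: cov_smooth => //; exact: smooth_vfZ.
  exact: (nablaZ nabla_conn _ oU sf sZ Uy).
have E2 : cov nabla (bracket X Y) (fun y => f y *: Z y) x =
    (dfun (fun y => dfun f y (Y y)) x (X x) - dfun (fun y => dfun f y (X y)) x (Y x))
      *: Z x + f x *: cov nabla (bracket X Y) Z x.
  rewrite -(bracket_dfun oU Ux sf sX sY).
  exact: (nablaZ nabla_conn (bracket X Y x) oU sf sZ Ux).
apply: etrans (sub3 (E1 X Y sX sY) (E1 Y X sY sX) E2) _.
vring.
Qed.

End Curvature.

Section Tensoriality.
Variables (R : realType) (m : nat) (M : manifold R m) (x : M) (U : set M).
Hypotheses (oU : open U) (Ux : U x) (Uchart : U `<=` dom (at_ x)).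
Variable T : vector_field M -> 'cV[R]_m.
Hypothesis T_ext : forall X Y : vector_field M, smooth_vf U X ->
  (forall y, U y -> X y = Y y) -> T X = T Y.
Hypothesis TD : forall X Y : vector_field M, smooth_vf U X -> smooth_vf U Y ->
  T (fun y => X y + Y y) = T X + T Y.
Hypothesis TZ : forall (f : M -> R) (X : vector_field M), smooth_fun U f ->
  smooth_vf U X -> T (fun y => f y *: X y) = f x *: T X.

(** In the coordinate frame, [X] and the field with constant components [X x] have coefficients that
    agree at [x], and linearity over functions sees only these values. *)
Lemma tensorial X : smooth_vf U X -> T X = T (extend x (X x)).
Proof.
move=> sX; pose E i := extend x (delta_mx i 0).
have sE i : smooth_vf U (E i) by apply: smooth_vf_sub (extend_smooth x _).
have Tsum (c : 'I_m -> M -> R) (r : seq 'I_m) : (forall i, smooth_fun U (c i)) ->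
    T (fun y => \sum_(i <- r) c i y *: E i y) = \sum_(i <- r) c i x *: T (E i).
  move=> sc; elim: r => [|i r IH].
    (* For the empty sum, [T] vanishes on the zero field by [TZ] with the zero function. *)
    rewrite big_nil -[RHS](scale0r (T (fun=> 0))).
    rewrite -(TZ (@smooth_fun_cst _ _ _ U 0)); last exact: smooth_vf0.
    by congr T; apply/funext => y; rewrite big_nil scaler0.
  rewrite big_cons -IH -(TZ (sc i)) // -TD; last first.
  - by apply: smooth_vf_sum => // j; exact: smooth_vfZ.
  - exact: smooth_vfZ.
  by congr T; apply/funext => y; rewrite big_cons.
rewrite (T_ext (Y := fun y => \sum_i comp_in x X y i 0 *: E i y)) //; last first.
  by move=> y /Uchart xy; exact: field_expand.
rewrite (Tsum (fun i y => comp_in x X y i 0)) => [|i]; last exact: comp_smooth.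
rewrite comp_in_id -(Tsum (fun i _ => X x i 0)) => [|i]; last exact: smooth_fun_cst.
by congr T; apply/funext => y; rewrite -extend_sum_delta.
Qed.

End Tensoriality.

(** * The curvature tensor at a point and the Bianchi identities *)

Section CurvatureAt.
Variables (R : realType) (m : nat) (M : manifold R m).
Variable nabla : M -> 'cV[R]_m -> vector_field M -> 'cV[R]_m.
Hypothesis nabla_conn : affine_connection nabla.
Hypothesis torsion_free : forall U (X Y : vector_field M),
  open U -> smooth_vf U X -> smooth_vf U Y ->
  forall x, U x -> cov nabla X Y x - cov nabla Y X x = bracket X Y x.
Implicit Types (U : set M) (p q x : M) (f h : M -> R) (X Y Z W : vector_field M).

Lemma curvature_atE U X Y Z x : open U -> U x -> smooth_vf U X -> smooth_vf U Y ->
  smooth_vf U Z ->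
  curvature nabla X Y Z x = curvature_at nabla x (X x) (Y x) (Z x).
Proof.
move=> oU0 U0x sX0 sY0 sZ0; pose U' := U `&` dom (at_ x).
have oU : open U' by apply: openI => //; exact: open_dom.
have Ux : U' x by split=> //; exact: at_dom.
have Uc : U' `<=` dom (at_ x) by move=> y [].
have UU : U' `<=` U by move=> y [].
have sX : smooth_vf U' X by apply: smooth_vf_sub sX0.
have sY : smooth_vf U' Y by apply: smooth_vf_sub sY0.
have sZ : smooth_vf U' Z by apply: smooth_vf_sub sZ0.
have sE u : smooth_vf U' (extend x u) by apply: smooth_vf_sub (extend_smooth x u).
have T1 A B C : smooth_vf U' A -> smooth_vf U' B -> smooth_vf U' C ->
    curvature nabla A B C x = curvature nabla (extend x (A x)) B C x.
  move=> sA sB sC.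
  apply: (@tensorial _ _ _ x U' oU Uc (fun A => curvature nabla A B C x)) sA.
  - move=> A1 A2 s1 AA.
    exact: (curvature_ext nabla_conn torsion_free oU Ux s1 sB sC AA
      (fun _ _ => erefl) (fun _ _ => erefl)).
  - move=> A1 A2 s1 s2.
    exact: (curvatureD1 nabla_conn torsion_free oU Ux s1 s2 sB sC).
  - move=> h A1 sh s1.
    exact: (curvatureZ1 nabla_conn torsion_free oU Ux sh s1 sB sC).
have T3 A B C : smooth_vf U' A -> smooth_vf U' B -> smooth_vf U' C ->
    curvature nabla A B C x = curvature nabla A B (extend x (C x)) x.
  move=> sA sB sC.
  apply: (@tensorial _ _ _ x U' oU Uc (fun C => curvature nabla A B C x)) sC.
  - move=> A1 A2 s1 AA.
    exact: (curvature_ext nabla_conn torsion_free oU Ux sA sB s1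
      (fun _ _ => erefl) (fun _ _ => erefl) AA).
  - move=> A1 A2 s1 s2.
    exact: (curvatureD3 nabla_conn oU Ux sA sB s1 s2).
  - move=> h A1 sh s1.
    exact: (curvatureZ3 nabla_conn oU Ux sh sA sB s1).
have skew A B C : smooth_vf U' A -> smooth_vf U' B -> smooth_vf U' C ->
    curvature nabla A B C x = - curvature nabla B A C x.
  by move=> sA sB sC; exact: (curvature_skew nabla_conn oU Ux sA sB sC).
(* The second slot is reached by exchanging it with the first, using skew-symmetry before and after
   [T1]. *)
rewrite /curvature_at (T1 X Y Z sX sY sZ) (T3 _ Y Z (sE _) sY sZ).
rewrite (skew _ Y _ (sE _) sY (sE _)) (T1 Y _ _ sY (sE _) (sE _)).
by rewrite (skew _ _ _ (sE _) (sE _) (sE _)) opprK.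
Qed.

(** By vanishing torsion, nabla_A nabla_B C - nabla_A nabla_C B = nabla_A [B, C] = [A, [B, C]] +
    nabla_{[B, C]} A. The cyclic sum leaves the Jacobi identity for the bracket. *)
Lemma bianchi1 U X Y Z x : open U -> U x -> smooth_vf U X -> smooth_vf U Y ->
  smooth_vf U Z ->
  curvature nabla X Y Z x + curvature nabla Y Z X x + curvature nabla Z X Y x = 0.
Proof.
move=> oU Ux sX sY sZ.
have H A B C : smooth_vf U A -> smooth_vf U B -> smooth_vf U C ->
    cov nabla A (cov nabla B C) x - cov nabla A (cov nabla C B) x =
    bracket A (bracket B C) x + cov nabla (bracket B C) A x.
  move=> sA sB sC; have sBC := bracket_smooth nabla_conn torsion_free oU sB sC.
  have s1 := cov_smooth nabla_conn oU sB sC.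
  have s2 := cov_smooth nabla_conn oU sC sB.
  rewrite (bracketE torsion_free oU sA sBC Ux) -/(cov nabla (bracket B C) A x) subrK.
  rewrite -[LHS](nablaB nabla_conn (A x) oU s1 s2 Ux).
  apply: (nabla_local nabla_conn _ oU _ Ux) => [|y Uy]; first exact: smooth_vfB.
  exact: (torsion_free oU sB sC Uy).
have := jacobi nabla_conn torsion_free oU sX sY sZ Ux.
have := H X Y Z sX sY sZ; have := H Y Z X sY sZ sX; have := H Z X Y sZ sX sY.
rewrite /curvature.
move: (bracket X _ x) (bracket Y _ x) (bracket Z _ x) => j1 j2 j3; vgen.
move=> /(canRL (subrK _)) -> /(canRL (subrK _)) -> /(canRL (subrK _)) -> J.
by rewrite -[RHS]J; vring.
Qed.

(* The curvature is not differentiated as a tensor: in this form, the second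
   Bianchi identity is the Jacobi identity for the operators [cov nabla X],
   [cov nabla Y] and [cov nabla W]. *)
Lemma bianchi2 U X Y W Z x : open U -> U x -> smooth_vf U X -> smooth_vf U Y ->
  smooth_vf U W -> smooth_vf U Z ->
  (cov nabla X (curvature nabla Y W Z) x - curvature nabla Y W (cov nabla X Z) x
     + curvature nabla X (bracket Y W) Z x) +
  (cov nabla Y (curvature nabla W X Z) x - curvature nabla W X (cov nabla Y Z) x
     + curvature nabla Y (bracket W X) Z x) +
  (cov nabla W (curvature nabla X Y Z) x - curvature nabla X Y (cov nabla W Z) x
     + curvature nabla W (bracket X Y) Z x) = 0.
Proof.
move=> oU Ux sX sY sW sZ.
have scov A B : smooth_vf U A -> smooth_vf U B -> smooth_vf U (cov nabla A B).
  by move=> sA sB; exact: (cov_smooth nabla_conn oU sA sB).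
have sbr A B : smooth_vf U A -> smooth_vf U B -> smooth_vf U (bracket A B).
  by move=> sA sB; exact: (bracket_smooth nabla_conn torsion_free oU sA sB).
have [j jE] : exists j : vector_field M -> vector_field M -> vector_field M -> 'cV[R]_m,
    forall A B C, j A B C = nabla x (bracket A (bracket B C) x) Z by eexists.
(* The terms mixing nabla_A with nabla_{[B, C]} cancel; what remains, apart from [j], is the
   commutator of nabla_A with [nabla_B, nabla_C] applied to Z. *)
have H A B C : smooth_vf U A -> smooth_vf U B -> smooth_vf U C ->
    cov nabla A (curvature nabla B C Z) x - curvature nabla B C (cov nabla A Z) x
     + curvature nabla A (bracket B C) Z x =
    (cov nabla A (cov nabla B (cov nabla C Z)) x - cov nabla A (cov nabla C (cov nabla B Z)) x)
    - (cov nabla B (cov nabla C (cov nabla A Z)) x - cov nabla C (cov nabla B (cov nabla A Z)) x)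
    - j A B C.
  move=> sA sB sC.
  have sBCZ := scov _ _ sB (scov _ _ sC sZ).
  have sCBZ := scov _ _ sC (scov _ _ sB sZ).
  have sbZ := scov _ _ (sbr _ _ sB sC) sZ.
  have -> : cov nabla A (curvature nabla B C Z) x =
      cov nabla A (cov nabla B (cov nabla C Z)) x - cov nabla A (cov nabla C (cov nabla B Z)) x
      - cov nabla A (cov nabla (bracket B C) Z) x.
    apply: etrans (nablaB nabla_conn (A x) oU (smooth_vfB oU sBCZ sCBZ) sbZ Ux) _.
    congr (_ - _); exact: (nablaB nabla_conn (A x) oU sBCZ sCBZ Ux).
  rewrite jE /curvature -/(cov nabla (bracket A (bracket B C)) Z x).
  by vring.
rewrite (H X Y W) // (H Y W X) // (H W X Y) //.
have J : j X Y W + j Y W X + j W X Y = 0.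
  rewrite !jE -!(nablaDl nabla_conn _ _ oU sZ Ux).
  rewrite (jacobi nabla_conn torsion_free oU sX sY sW Ux).
  exact: (nabla0l nabla_conn oU sZ Ux).
apply: etrans (_ : - (j X Y W + j Y W X + j W X Y) = 0); last by rewrite J oppr0.
move: (j X Y W) (j Y W X) (j W X Y) => j1 j2 j3; vring.
Qed.

Lemma curvature_at_skew x u v w : curvature_at nabla x u v w = - curvature_at nabla x v u w.
Proof.
exact: (curvature_skew nabla_conn (@open_dom _ _ _ (at_ x)) (at_dom x)
  (extend_smooth x u) (extend_smooth x v) (extend_smooth x w)).
Qed.

Lemma extendD x u v : extend x (u + v) = (fun y : M => extend x u y + extend x v y).
Proof. by apply/funext => y; exact: tchangeD. Qed.

Lemma extendZ x a u : extend x (a *: u) = (fun y : M => a *: extend x u y).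
Proof. by apply/funext => y; exact: tchangeZ. Qed.

Lemma curvature_atD1 x u u' v w : curvature_at nabla x (u + u') v w =
  curvature_at nabla x u v w + curvature_at nabla x u' v w.
Proof.
rewrite /curvature_at extendD.
exact: (curvatureD1 nabla_conn torsion_free (@open_dom _ _ _ (at_ x)) (at_dom x)
  (extend_smooth x u) (extend_smooth x u') (extend_smooth x v) (extend_smooth x w)).
Qed.

Lemma curvature_atZ1 x a u v w :
  curvature_at nabla x (a *: u) v w = a *: curvature_at nabla x u v w.
Proof.
rewrite /curvature_at extendZ.
exact: (curvatureZ1 nabla_conn torsion_free (@open_dom _ _ _ (at_ x)) (at_dom x)
  (@smooth_fun_cst _ _ _ _ a) (extend_smooth x u) (extend_smooth x v) (extend_smooth x w)).
Qed.

Lemma curvature_atD2 x u v v' w : curvature_at nabla x u (v + v') w =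
  curvature_at nabla x u v w + curvature_at nabla x u v' w.
Proof.
rewrite (curvature_at_skew x u (v + v') w) curvature_atD1 opprD.
by congr (_ + _); symmetry; exact: curvature_at_skew.
Qed.

Lemma curvature_atZ2 x a u v w :
  curvature_at nabla x u (a *: v) w = a *: curvature_at nabla x u v w.
Proof.
rewrite (curvature_at_skew x u (a *: v) w) curvature_atZ1 -scalerN; congr (_ *: _).
by symmetry; exact: curvature_at_skew.
Qed.

Lemma curvature_atD3 x u v w w' : curvature_at nabla x u v (w + w') =
  curvature_at nabla x u v w + curvature_at nabla x u v w'.
Proof.
rewrite /curvature_at extendD.
exact: (curvatureD3 nabla_conn (@open_dom _ _ _ (at_ x)) (at_dom x)
  (extend_smooth x u) (extend_smooth x v) (extend_smooth x w) (extend_smooth x w')).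
Qed.

Lemma curvature_atZ3 x a u v w :
  curvature_at nabla x u v (a *: w) = a *: curvature_at nabla x u v w.
Proof.
rewrite /curvature_at extendZ.
exact: (curvatureZ3 nabla_conn (@open_dom _ _ _ (at_ x)) (at_dom x)
  (@smooth_fun_cst _ _ _ _ a) (extend_smooth x u) (extend_smooth x v) (extend_smooth x w)).
Qed.

Lemma curvature_at_bianchi x u v w :
  curvature_at nabla x u v w + curvature_at nabla x v w u + curvature_at nabla x w u v = 0.
Proof.
exact: (bianchi1 (@open_dom _ _ _ (at_ x)) (at_dom x)
  (extend_smooth x u) (extend_smooth x v) (extend_smooth x w)).
Qed.

End CurvatureAt.

(** * Traces, metrics and gradients *)

Section Trace.
Variables (R : realType) (m : nat) (M : manifold R m).

Definition lin_mx_of (L : 'cV[R]_m -> 'cV[R]_m) : 'M[R]_m :=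
  \matrix_(i, j) L (delta_mx j 0) i 0.

Lemma sum_kronecker (a : 'I_m -> R) j : \sum_i a i * (i == j)%:R = a j.
Proof.
rewrite (bigD1 j) //= eqxx mulr1 big1 ?addr0 // => i /negPf ->.
by rewrite mulr0.
Qed.

Lemma endo_traceE (L : 'cV[R]_m -> 'cV[R]_m) :
  endo_trace L = \sum_i L (delta_mx i 0) i 0.
Proof. by rewrite /endo_trace /mxtrace; apply: eq_bigr => i _; rewrite mxE. Qed.

Lemma lin_mx_ofE (L : 'cV[R]_m -> 'cV[R]_m) v :
  (forall u v, L (u + v) = L u + L v) -> (forall a u, L (a *: u) = a *: L u) ->
  lin_mx_of L *m v = L v.
Proof.
move=> LD LZ; have L0 : L 0 = 0 by have := LZ 0 0; rewrite !scale0r.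
apply/matrixP => i j; rewrite ord1 mxE {2}(cV_sum_delta v).
have -> : L (\sum_k v k 0 *: delta_mx k 0) = \sum_k v k 0 *: L (delta_mx k 0).
  by elim/big_rec2: _ => [//|k a b _ E]; rewrite LD LZ E.
by rewrite summxE; apply: eq_bigr => k _; rewrite !mxE mulrC.
Qed.

Lemma mulmx_delta (T : 'M[R]_m) i j : (T *m delta_mx j (0 : 'I_1)) i 0 = T i j.
Proof. by rewrite -colE mxE. Qed.

Lemma endo_trace_mx (T : 'M[R]_m) : endo_trace (mulmx T : 'cV[R]_m -> _) = \tr T.
Proof. by rewrite endo_traceE /mxtrace; apply: eq_bigr => i _; rewrite mulmx_delta. Qed.

(** [T y] is a matrix in the chart at [y], which varies with [y]. Passing to the fixed chart [p] is
    a conjugation, so the trace is unchanged and its smoothness becomes visible. *)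
Lemma mxtrace_chart (T : M -> 'M[R]_m) (p y : M) : dom (at_ p) y ->
  \tr (T y) =
  \sum_i comp_in p (fun z => T z *m extend p (delta_mx i 0) z) y i 0.
Proof.
move=> py; have yy := at_dom y.
have [P PE] : exists P, forall v, P *m v = tchange p y y v.
  exists (lin_mx_of (tchange p y y)) => v.
  by apply: lin_mx_ofE => *; [exact: tchangeD|exact: tchangeZ].
have [Q QE] : exists Q, forall v, Q *m v = tchange y p y v.
  exists (lin_mx_of (tchange y p y)) => v.
  by apply: lin_mx_ofE => *; [exact: tchangeD|exact: tchangeZ].
have QP : P *m Q = 1%:M.
  apply/matrixP => i j.
  have : (P *m Q) *m delta_mx j 0 = 1%:M *m delta_mx j (0 : 'I_1).
    by rewrite -mulmxA QE PE (tchange_comp _ yy py yy) (tchange_id _ yy) mul1mx.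
  by move=> /(congr1 (fun v : 'cV[R]_m => v i 0)); rewrite !mulmx_delta.
rewrite -[T y]mulmx1 -QP mulmxA mxtrace_mulC mulmxA /mxtrace; apply: eq_bigr => i _.
by rewrite -[LHS]mulmx_delta -!mulmxA PE QE.
Qed.

Lemma mxtrace_smooth (U : set M) (T : M -> 'M[R]_m) : open U ->
  (forall V X, open V -> V `<=` U -> smooth_vf V X -> smooth_vf V (fun y => T y *m X y)) ->
  smooth_fun U (fun y => \tr (T y)).
Proof.
move=> oU sT; apply: smooth_fun_local => p Up; pose U' := U `&` dom (at_ p).
exists U'; first by split=> //; exact: at_dom.
have oU' : open U' by apply: openI => //; exact: open_dom.
pose E i := extend p (delta_mx i 0).
have sE i : smooth_vf U' (E i) by apply: (smooth_vf_sub _ (extend_smooth p _)) => y [].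
apply: (smooth_fun_ext (f := fun y => \sum_i comp_in p (fun z => T z *m E i z) y i 0) oU').
  by move=> y [_ py]; rewrite (mxtrace_chart T py).
apply: smooth_fun_sum => // i; apply: comp_smooth => //; first by move=> y [].
by apply: sT => // y [].
Qed.

Variable nabla : M -> 'cV[R]_m -> vector_field M -> 'cV[R]_m.
Hypothesis nabla_conn : affine_connection nabla.

(** This is u(tr T) = tr(nabla_u T). In the coordinate frame, the covariant derivatives of the frame
    fields contribute the trace of a commutator, which vanishes. *)
Lemma dfun_trace (U : set M) (T : M -> 'M[R]_m) (x : M) u : open U -> U x ->
  (forall V X, open V -> V `<=` U -> smooth_vf V X -> smooth_vf V (fun y => T y *m X y)) ->
  dfun (fun y => \tr (T y)) x u = endo_trace (fun w =>
    nabla x u (fun y => T y *m extend x w y) - T x *m nabla x u (extend x w)).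
Proof.
move=> oU0 U0x sT0; pose U' := U `&` dom (at_ x).
have oU : open U' by apply: openI => //; exact: open_dom.
have Ux : U' x by split=> //; exact: at_dom.
have Uc : U' `<=` dom (at_ x) by move=> y [].
pose E i := extend x (delta_mx i 0).
have sE i : smooth_vf U' (E i) by apply: smooth_vf_sub (extend_smooth x _).
have sT i : smooth_vf U' (fun y => T y *m E i y) by apply: sT0 => // y [].
pose c i j y := comp_in x (fun z => T z *m E j z) y i 0.
have sc i j : smooth_fun U' (c i j) by exact: comp_smooth.
have cx i j : c i j x = T x i j.
  by rewrite /c comp_in_id /E extend_at mulmx_delta.
have -> : dfun (fun y => \tr (T y)) x u = \sum_i dfun (c i i) x u.
  apply: etrans (@dfun_sum _ _ _ U' _ _ (fun i => c i i) x u oU (fun i => sc i i) Ux).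
  symmetry; apply: (dfun_ext _ oU _ Ux).
    exact: (@smooth_fun_sum _ _ _ U' _ _ _ (fun i => c i i) oU (fun i => sc i i)).
  by move=> y [_ xy]; rewrite (mxtrace_chart T xy).
have nT j : nabla x u (fun y => T y *m E j y) =
    \sum_i (dfun (c i j) x u *: delta_mx i 0 + T x i j *: nabla x u (E i)).
  rewrite (nabla_local nabla_conn (Z := fun y => \sum_i c i j y *: E i y) u oU (sT j) Ux).
    rewrite (nabla_sum nabla_conn (X := fun i y => c i j y *: E i y) _ u oU _ Ux).
      by apply: eq_bigr => i _; rewrite (nablaZ nabla_conn u oU (sc i j) (sE i) Ux) cx /E extend_at.
    by move=> i; exact: smooth_vfZ.
  by move=> y [_ xy]; exact: (field_expand (fun y => T y *m E j y) xy).
pose s i j := nabla x u (E i) j 0.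
rewrite endo_traceE.
transitivity (\sum_j (dfun (c j j) x u + (\sum_i T x i j * s i j - \sum_i T x j i * s j i))).
  by rewrite big_split /= sumrB [X in _ = _ + (X - _)]exchange_big subrr addr0.
apply: eq_bigr => j _; rewrite -/(E j) [in RHS]mxE [X in _ = _ + X]mxE nT summxE.
rewrite [in RHS]mxE addrA; congr (_ - _).
have -> : dfun (c j j) x u = \sum_i dfun (c i j) x u * (i == j)%:R.
  exact: esym (sum_kronecker (fun i => dfun (c i j) x u) j).
rewrite -big_split; apply: eq_bigr => i _ /=.
by rewrite !mxE eqxx andbT eq_sym.
Qed.

End Trace.

Section Metric.
Variables (R : realType) (m : nat) (M : manifold R m) (g : M -> 'M[R]_m).
Implicit Types (x : M) (u v w : 'cV[R]_m).

Lemma bil_atDl x u v w : bil_at g x (u + v) w = bil_at g x u w + bil_at g x v w.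
Proof. by rewrite /bil_at linearD /= !mulmxDl mxE. Qed.

Lemma bil_atZl x a u w : bil_at g x (a *: u) w = a * bil_at g x u w.
Proof. by rewrite /bil_at linearZ /= -!scalemxAl mxE. Qed.

Lemma bil_atDr x u v w : bil_at g x u (v + w) = bil_at g x u v + bil_at g x u w.
Proof. by rewrite /bil_at mulmxDr mxE. Qed.

Lemma bil_atZr x a u w : bil_at g x u (a *: w) = a * bil_at g x u w.
Proof. by rewrite /bil_at -scalemxAr mxE. Qed.

Lemma bil_at0l x w : bil_at g x 0 w = 0.
Proof. by have := bil_atZl x 0 0 w; rewrite scale0r mul0r. Qed.

Lemma bil_at0r x w : bil_at g x w 0 = 0.
Proof. by have := bil_atZr x 0 w 0; rewrite scale0r mul0r. Qed.

Lemma bil_atNl x u w : bil_at g x (- u) w = - bil_at g x u w.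
Proof. by rewrite -scaleN1r bil_atZl mulN1r. Qed.

Lemma bil_atNr x u w : bil_at g x u (- w) = - bil_at g x u w.
Proof. by rewrite -scaleN1r bil_atZr mulN1r. Qed.

Definition bil_atE := (bil_atDl, bil_atDr, bil_atZl, bil_atZr, bil_atNl, bil_atNr).

Lemma bil_at_suml x (I : Type) (r : seq I) (u : I -> 'cV[R]_m) w :
  bil_at g x (\sum_(i <- r) u i) w = \sum_(i <- r) bil_at g x (u i) w.
Proof.
by elim/big_rec2: _ => [|i a b _ <-]; [exact: bil_at0l|exact: bil_atDl].
Qed.

Lemma bil_at_sumr x (I : Type) (r : seq I) (u : I -> 'cV[R]_m) w :
  bil_at g x w (\sum_(i <- r) u i) = \sum_(i <- r) bil_at g x w (u i).
Proof.
by elim/big_rec2: _ => [|i a b _ <-]; [exact: bil_at0r|exact: bil_atDr].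
Qed.

Hypothesis gP : riemannian_metric g.

Lemma bil_atC x u v : bil_at g x u v = bil_at g x v u.
Proof. exact: (Defs.metric_sym gP). Qed.

Lemma bil_at_inj x u v : (forall w, bil_at g x u w = bil_at g x v w) -> u = v.
Proof.
move=> H; apply/eqP; rewrite -subr_eq0; apply/negPn/negP => n0.
have := metric_pos gP x n0; rewrite {1}/GRing.add /= bil_atDl bil_atNl H subrr ltxx.
by [].
Qed.

Lemma metric_unit x : g x \in unitmx.
Proof.
rewrite -row_free_unit -kermx_eq0; apply/negPn/negP => /rowV0Pn [v /sub_kermxP vg v0].
have vt0 : v^T != 0 by apply: contra_neq v0 => E; rewrite -[v]trmxK E trmx0.
by have := metric_pos gP x vt0; rewrite /bil_at trmxK vg mul0mx mxE ltxx.
Qed.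

Lemma metric_tr x : (g x)^T = g x.
Proof.
apply/matrixP => i j; rewrite mxE.
have E k l : bil_at g x (delta_mx k 0) (delta_mx l 0) = g x k l.
  by rewrite /bil_at trmx_delta -mulmxA -rowE mxE mulmx_delta.
by rewrite -!E bil_atC.
Qed.

Lemma bil_grad (f : M -> R) x v : bil_at g x (grad g f x) v = dfun f x v.
Proof.
rewrite /bil_at /grad trmx_mul trmx_inv metric_tr mulmxKV ?metric_unit //.
rewrite mxE dfun_sumr.
by apply: eq_bigr => i _; rewrite !mxE mulrC.
Qed.

Lemma smooth_det n (U : set M) (A : M -> 'M[R]_n) : open U ->
  (forall i j, smooth_fun U (fun y => A y i j)) -> smooth_fun U (fun y => \det (A y)).
Proof.
move=> oU sA; apply: smooth_fun_sum => // s; apply: smooth_funM => //.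
  exact: smooth_fun_cst.
by apply: smooth_fun_prod.
Qed.

Lemma smooth_invmx n (U : set M) (A : M -> 'M[R]_n) : open U ->
  (forall y, U y -> A y \in unitmx) ->
  (forall i j, smooth_fun U (fun y => A y i j)) ->
  forall i j, smooth_fun U (fun y => invmx (A y) i j).
Proof.
move=> oU uA sA i j.
apply: (smooth_fun_ext (f := fun y => (\det (A y))^-1 * cofactor (A y) j i)) => //.
  by move=> y Uy; rewrite /invmx uA // !mxE.
apply: smooth_funM => //.
  apply: smooth_funV => //; last exact: smooth_det.
  by move=> y Uy; have := uA y Uy; rewrite unitmxE unitfE.
apply: smooth_funM => //; first exact: smooth_fun_cst.
apply: smooth_det => // k l.
by apply: smooth_fun_ext (sA (lift j k) (lift i l)) => // y _; rewrite !mxE.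
Qed.

(** [grad] inverts [g x] in a chart depending on [x], so another expression is shown to be smooth:
    the one using the inverse Gram matrix of a fixed coordinate frame. Nondegeneracy of [g]
    identifies the two. *)
Lemma grad_smooth (U : set M) (f : M -> R) : open U -> smooth_fun U f ->
  smooth_vf U (grad g f).
Proof.
move=> oU sf; apply: smooth_vf_local => p Up; pose U' := U `&` dom (at_ p).
exists U'; first by split=> //; exact: at_dom.
have oU' : open U' by apply: openI => //; exact: open_dom.
pose E i := extend p (delta_mx i 0).
have sE i : smooth_vf U' (E i) by apply: smooth_vf_sub (extend_smooth p _) => y [].
pose G y := \matrix_(i, j) bil_at g y (E i y) (E j y).
have GE y w v : bil_at g y (\sum_i w i 0 *: E i y) (\sum_i v i 0 *: E i y) =
    (w^T *m G y *m v) 0 0.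
  rewrite bil_at_sumr -mulmxA mxE; under eq_bigr do rewrite bil_at_suml.
  rewrite exchange_big; apply: eq_bigr => i _; rewrite !mxE mulr_sumr.
  by apply: eq_bigr => j _; rewrite bil_atZl bil_atZr !mxE; ring.
have uG y : U' y -> G y \in unitmx.
  move=> [_ py]; rewrite -row_free_unit -kermx_eq0.
  apply/negPn/negP => /rowV0Pn [v /sub_kermxP vg v0].
  have : (\sum_i v^T i 0 *: E i y) != 0.
    apply: contra_neq v0 => E0.
    have vt0 : v^T = 0.
      apply: (etrans (esym (comp_in_extend v^T py))).
      by rewrite /comp_in extend_sum_delta E0 tchange0.
    by rewrite -[v]trmxK vt0 trmx0.
  by move=> /(@metric_pos _ _ _ _ gP y _); rewrite GE trmxK vg mul0mx mxE ltxx.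
have sG i j : smooth_fun U' (fun y => G y i j).
  apply: (smooth_fun_ext (f := fun y => bil_at g y (E i y) (E j y))) => //.
    by move=> y _; rewrite mxE.
  exact: (metric_smooth gP).
pose b y : 'cV[R]_m := \col_j dfun f y (E j y).
pose w y := invmx (G y) *m b y.
apply: (smooth_vf_ext (X := fun y => \sum_i w y i 0 *: E i y)) => //.
  move=> y [Uy py]; apply: (@bil_at_inj y) => v; rewrite bil_grad.
  rewrite (field_expand (fun=> v) py); set c := comp_in p (fun=> v) y.
  rewrite -/(E _) GE /w trmx_mul.
  have -> : (invmx (G y))^T = invmx (G y).
    rewrite trmx_inv; congr invmx; apply/matrixP => i j; rewrite !mxE.
    exact: bil_atC.
  rewrite mulmxKV; last exact: uG.
  rewrite mxE -extend_sum_delta /extend; rewrite tchange_sum_delta.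
  elim/big_rec2: _ => [|i A B _ ->]; first by rewrite dfun0r.
  by rewrite dfunDr dfunZr !mxE mulrC.
apply: smooth_vf_sum => // i; apply: smooth_vfZ => //.
apply: (smooth_fun_ext (f := fun y => \sum_j invmx (G y) i j * dfun f y (E j y))) => //.
  by move=> y _; rewrite [RHS]mxE; apply: eq_bigr => j _; rewrite !mxE.
apply: smooth_fun_sum => // j; apply: smooth_funM => //; first exact: smooth_invmx.
by apply: dfun_smooth => //; apply: smooth_fun_sub sf => y [].
Qed.

End Metric.

(** * Traces of endomorphisms of a tangent space *)

Section EndoTrace.
Variables (R : realType) (m : nat).
Implicit Types (A B : 'cV[R]_m -> 'cV[R]_m) (F : 'M[R]_m).

Lemma eq_endo_trace A B : A =1 B -> endo_trace A = endo_trace B.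
Proof. by move=> AB; congr endo_trace; apply/funext. Qed.

Lemma endo_traceD A B : endo_trace (fun w => A w + B w) = endo_trace A + endo_trace B.
Proof. by rewrite !endo_traceE -big_split; apply: eq_bigr => i _; rewrite mxE. Qed.

Lemma endo_traceZ a A : endo_trace (fun w => a *: A w) = a * endo_trace A.
Proof. by rewrite !endo_traceE mulr_sumr; apply: eq_bigr => i _; rewrite mxE. Qed.

Lemma endo_traceN A : endo_trace (fun w => - A w) = - endo_trace A.
Proof. by rewrite !endo_traceE -sumrN; apply: eq_bigr => i _; rewrite mxE. Qed.

Lemma endo_traceB A B : endo_trace (fun w => A w - B w) = endo_trace A - endo_trace B.
Proof. by rewrite endo_traceD endo_traceN. Qed.

Lemma endo_trace_id : endo_trace (fun w : 'cV[R]_m => w) = m%:R.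
Proof.
rewrite endo_traceE (eq_bigr (fun=> 1)) => [|i _]; last by rewrite mxE !eqxx.
by rewrite sumr_const card_ord.
Qed.

Lemma endo_trace_rank1 (h : 'cV[R]_m -> R) u :
  (forall v w, h (v + w) = h v + h w) -> (forall a v, h (a *: v) = a * h v) ->
  endo_trace (fun w => h w *: u) = h u.
Proof.
move=> hD hZ; have h0 : h 0 = 0 by have := hZ 0 0; rewrite scale0r mul0r.
rewrite endo_traceE [in RHS](cV_sum_delta u).
have -> : h (\sum_i u i 0 *: delta_mx i 0) = \sum_i u i 0 * h (delta_mx i 0).
  by elim/big_rec2: _ => [//|i a c _ E]; rewrite hD hZ E.
by apply: eq_bigr => i _; rewrite mxE mulrC.
Qed.

(** The shape is that of [nabla_xi_curvature] with phi inserted in two slots, where the metric terms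
    are the two rank-one maps. *)
Lemma endo_trace_comb A1 A2 A3 (h1 h2 : 'cV[R]_m -> R) c u1 u2 :
  (forall v w, h1 (v + w) = h1 v + h1 w) -> (forall a v, h1 (a *: v) = a * h1 v) ->
  (forall v w, h2 (v + w) = h2 v + h2 w) -> (forall a v, h2 (a *: v) = a * h2 v) ->
  endo_trace (fun w => A1 w + A2 w - c *: (A3 w + (h1 w *: u1 - h2 w *: u2))) =
  endo_trace A1 + endo_trace A2 - c * (endo_trace A3 + (h1 u1 - h2 u2)).
Proof.
move=> D1 Z1 D2 Z2; rewrite -(endo_trace_rank1 _ D1 Z1) -(endo_trace_rank1 _ D2 Z2).
by rewrite -endo_traceB -(endo_traceD A3) -endo_traceZ -(endo_traceD A1) -endo_traceB.
Qed.

Lemma endo_trace_lin A :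
  (forall u v, A (u + v) = A u + A v) -> (forall a u, A (a *: u) = a *: A u) ->
  exists2 T : 'M[R]_m, (forall v, T *m v = A v) & endo_trace A = \tr T.
Proof.
move=> AD AZ; exists (lin_mx_of A); first by move=> v; exact: lin_mx_ofE.
by [].
Qed.

Lemma endo_traceC F A :
  (forall u v, A (u + v) = A u + A v) -> (forall a u, A (a *: u) = a *: A u) ->
  endo_trace (fun w => A (F *m w)) = endo_trace (fun w => F *m A w).
Proof.
move=> AD AZ; have [T TE _] := endo_trace_lin AD AZ.
transitivity (\tr (T *m F)).
  by rewrite -endo_trace_mx; apply: eq_endo_trace => w; rewrite -TE mulmxA.
rewrite mxtrace_mulC -endo_trace_mx.
by apply: eq_endo_trace => w; rewrite -TE mulmxA.
Qed.

Variables (M : manifold R m) (g : M -> 'M[R]_m) (x : M).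
Hypothesis gP : riemannian_metric g.

(** In matrices, adjointness reads [S^T *m g x = g x *m T]: the transpose of [S] is conjugate to
    [T]. *)
Lemma endo_trace_adjoint A B :
  (forall u v, A (u + v) = A u + A v) -> (forall a u, A (a *: u) = a *: A u) ->
  (forall u v, B (u + v) = B u + B v) -> (forall a u, B (a *: u) = a *: B u) ->
  (forall u v, bil_at g x (A u) v = bil_at g x u (B v)) ->
  endo_trace A = endo_trace B.
Proof.
move=> AD AZ BD BZ AB.
have [S SE ->] := endo_trace_lin AD AZ; have [T TE ->] := endo_trace_lin BD BZ.
have E : S^T *m g x = g x *m T.
  apply/matrixP => i j; have := AB (delta_mx i 0) (delta_mx j 0).
  rewrite -SE -TE /bil_at trmx_mul trmx_delta -!mulmxA -!rowE ![row _ _ _ _]mxE.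
  by rewrite !mulmxA !mulmx_delta.
rewrite -mxtrace_tr -[S^T](mulmxK (metric_unit gP x)) E mxtrace_mulC.
by rewrite mulmxA mulVmx ?mul1mx //; exact: metric_unit.
Qed.

End EndoTrace.

(** * Kenmotsu curvature *)

Section PointwiseKenmotsu.
Variables (R : realType) (m : nat) (M : manifold R m) (g : M -> 'M[R]_m) (x : M).
Hypothesis gP : riemannian_metric g.
Local Notation b := (bil_at g x).
Variable K : 'cV[R]_m -> 'cV[R]_m -> 'cV[R]_m -> 'cV[R]_m.
Hypothesis KD1 : forall u u' v w, K (u + u') v w = K u v w + K u' v w.
Hypothesis KZ1 : forall a u v w, K (a *: u) v w = a *: K u v w.
Hypothesis KD3 : forall u v w w', K u v (w + w') = K u v w + K u v w'.
Hypothesis KZ3 : forall a u v w, K u v (a *: w) = a *: K u v w.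
Hypothesis K_skew : forall u v w, K u v w = - K v u w.
Hypothesis K_bianchi : forall u v w, K u v w + K v w u + K w u v = 0.
Hypothesis K_metric : forall u v w z, b (K u v w) z = - b (K u v z) w.

(** The classical argument: in the four Bianchi identities, one for each choice of the last vector,
    skew-symmetry in both pairs makes all other terms cancel. Everything is linear in the listed
    instances. *)
Lemma curvature_pair u v w z : b (K u v w) z = b (K w z u) v.
Proof.
have B u1 u2 u3 u4 : b (K u1 u2 u3) u4 + b (K u2 u3 u1) u4 + b (K u3 u1 u2) u4 = 0.
  by rewrite -!bil_atDl K_bianchi bil_at0l.
have S u1 u2 u3 u4 : b (K u1 u2 u3) u4 = - b (K u2 u1 u3) u4.
  by rewrite {1}K_skew bil_atNl.
have := B u v w z; have := B v w z u; have := B w z u v; have := B z u v w.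
have := K_metric u v w z; have := K_metric v w u z; have := K_metric w u v z.
have := K_metric v w z u; have := K_metric w z v u; have := K_metric z v w u.
have := K_metric w z u v; have := K_metric z u w v; have := K_metric u w z v.
have := K_metric z u v w; have := K_metric u v z w; have := K_metric v z u w.
have := S u v w z; have := S u w v z; have := S w z u v; have := S z v w u.
have := S z u v w; have := S v w z u; have := S u w z v; have := S v z u w.
have := S w v u z; have := S z w u v.
lra.
Qed.

Variables (F : 'M[R]_m) (k : 'cV[R]_m) (e : 'cV[R]_m -> R).
Hypothesis F2 : forall u, F *m (F *m u) = - u + e u *: k.
Hypothesis F_compat : forall u v, b (F *m u) (F *m v) = b u v - e u * e v.
Hypothesis eE : forall u, e u = b u k.
Hypothesis F_skew : forall u v, b (F *m u) v = - b u (F *m v).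
Hypothesis K_k : forall u v, K u v k = e u *: v - e v *: u.
Hypothesis K_F : forall u v w, K u v (F *m w) = F *m K u v w + b (F *m v) w *: u
  - b (F *m u) w *: v - b u w *: (F *m v) + b v w *: (F *m u).

Lemma eD u v : e (u + v) = e u + e v.
Proof. by rewrite !eE bil_atDl. Qed.

Lemma eZ a u : e (a *: u) = a * e u.
Proof. by rewrite !eE bil_atZl. Qed.

(** [F] is skew-adjoint, so it has the same trace as its negative. *)
Lemma trace_F : endo_trace (fun w : 'cV[R]_m => F *m w) = 0.
Proof.
have : endo_trace (fun w : 'cV[R]_m => F *m w) = endo_trace (fun w : 'cV[R]_m => - (F *m w)).
  apply: (endo_trace_adjoint (x := x) gP); try by move=> *; vring.
  - by move=> *; rewrite mulmxDr.
  - by move=> *; rewrite -scalemxAr.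
  - by move=> *; rewrite mulmxDr opprD.
  - by move=> *; rewrite -scalemxAr scalerN.
  - by move=> u v; rewrite F_skew bil_atNr.
rewrite endo_traceN; lra.
Qed.

(** Pair symmetry moves [k] from the first slot to the third, where [K_k] applies. *)
Lemma curvature_k u v : K k u v = e v *: u - b u v *: k.
Proof.
apply: (bil_at_inj gP (x := x)) => w.
rewrite curvature_pair K_k !bil_atE !eE (bil_atC gP x k w) (bil_atC gP x u w).
by rewrite (bil_atC gP x u v); ring.
Qed.

(** The Bianchi identity splits the trace, up to sign, into two traces that both equal [P]. In [P],
    one [F] is carried around the trace and past [K] by [K_F], where it meets the other one; F^2
    then brings back the Ricci trace. *)
Lemma star_ricci_ricci u v :
  2%:R^-1 * endo_trace (fun w => K u (F *m v) (F *m w)) =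
  endo_trace (fun w => K w u v) + (m%:R - 2) * b u v + e u * e v.
Proof.
pose P := endo_trace (fun w => K (F *m w) u (F *m v)).
have FD (u1 v1 : 'cV[R]_m) : F *m (u1 + v1) = F *m u1 + F *m v1 by rewrite mulmxDr.
have FZ a (u1 : 'cV[R]_m) : F *m (a *: u1) = a *: (F *m u1) by rewrite -scalemxAr.
have KD2 u1 v1 v2 w : K u1 (v1 + v2) w = K u1 v1 w + K u1 v2 w.
  by rewrite K_skew KD1 opprD -!(K_skew u1).
have KZ2 a u1 v1 w : K u1 (a *: v1) w = a *: K u1 v1 w.
  by rewrite K_skew KZ1 -scalerN -(K_skew u1).
(* By the pair symmetry, the two endomorphisms are adjoint up to sign and a
   cyclic permutation of factors. *)
have T2 : endo_trace (fun w => K (F *m v) (F *m w) u) = P.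
  transitivity (- endo_trace (fun w => F *m K w (F *m v) u)).
    rewrite -(endo_traceC F (A := fun w => K w (F *m v) u)).
    - by rewrite -endo_traceN; apply: eq_endo_trace => w; rewrite K_skew.
    - by move=> *; rewrite KD1.
    - by move=> *; rewrite KZ1.
  apply/eqP; rewrite -eqr_opp opprK -endo_traceN; apply/eqP.
  apply: (endo_trace_adjoint (x := x) gP).
  - by move=> *; rewrite KD1 FD.
  - by move=> *; rewrite KZ1 FZ.
  - by move=> *; rewrite FD KD1 opprD.
  - by move=> *; rewrite FZ KZ1 scalerN.
  - move=> w z; rewrite F_skew curvature_pair K_metric opprK K_skew bil_atNl bil_atNr.
    by rewrite (bil_atC gP).
have PE : P = - endo_trace (fun w => K w u v) + (1 - m%:R) * (e u * e v)
    + (2 - m%:R) * (b u v - e u * e v).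
  rewrite /P (endo_traceC F (A := fun w => K w u (F *m v))); last 2 first.
  - by move=> *; rewrite KD1.
  - by move=> *; rewrite KZ1.
  (* [K_F] with third argument [F *m v] gives F K(w, u)F v in terms of K(w, u)F^2 v, that is, of -
     K(w, u)v + e(v) K(w, u)k. The multiples of [w] are the source of the dimension in the
     result. *)
  rewrite (eq_endo_trace (B := fun w => (((- K w u v + (e v * e w) *: u)
     - (e v * e u + b (F *m u) (F *m v)) *: w)
     + (b (F *m w) (F *m v) *: u + b w (F *m v) *: (F *m u)))
     - b u (F *m v) *: (F *m w))); last first.
    move=> w; have := K_F w u (F *m v); rewrite F2 KD3 KZ3 K_k.
    rewrite -scaleN1r KZ3.
    move: (b (F *m u) (F *m v)) (b (F *m w) (F *m v)) (b w (F *m v)) (b u (F *m v)).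
    move: (F *m K w u (F *m v)) (K w u v) (F *m u) (F *m w) => A C f1 f2 b1 b2 b3 b4 E.
    have -> : A = -1 *: C + e v *: (e w *: u - e u *: w) - b1 *: w + b2 *: u + b3 *: f1 - b4 *: f2.
      by rewrite E; vring.
    vring.
  rewrite endo_traceB endo_traceD endo_traceB !endo_traceD endo_traceN !endo_traceZ.
  rewrite endo_trace_id trace_F.
  rewrite (endo_trace_rank1 (h := fun w => e v * e w)); first last.
  - by move=> *; rewrite eZ; ring.
  - by move=> *; rewrite eD; ring.
  rewrite (endo_trace_rank1 (h := fun w => b (F *m w) (F *m v))); first last.
  - by move=> *; rewrite FZ bil_atZl.
  - by move=> *; rewrite FD bil_atDl.
  rewrite (endo_trace_rank1 (h := fun w => b w (F *m v))); first last.
  - by move=> *; rewrite bil_atZl.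
  - by move=> *; rewrite bil_atDl.
  rewrite F_compat; ring.
have -> : endo_trace (fun w => K u (F *m v) (F *m w)) = - 2 * P.
  rewrite (eq_endo_trace (B := fun w => - (K (F *m v) (F *m w) u + K (F *m w) u (F *m v)))).
    by rewrite endo_traceN endo_traceD T2 -/P; ring.
  move=> w; apply/eqP; rewrite -subr_eq0 opprK addrA; apply/eqP; exact: K_bianchi.
by rewrite PE; field.
Qed.

End PointwiseKenmotsu.

(** * Covariant derivatives of xi, eta and phi, and their effect on the curvature *)

Section Kenmotsu.
Variables (R : realType) (m : nat) (M : manifold R m).
Variables (phi : M -> 'M[R]_m) (xi : vector_field M) (eta : M -> 'rV[R]_m).
Variables (g : M -> 'M[R]_m) (nabla : M -> 'cV[R]_m -> vector_field M -> 'cV[R]_m).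
Hypothesis kenm : kenmotsu phi xi eta g nabla.
Implicit Types (U : set M) (x : M) (X Y Z W : vector_field M) (u v w : 'cV[R]_m).
Local Notation b := (bil_at g).
Local Notation e := (form_at eta).

Let acm := kenmotsu_acm kenm.
Let gP : riemannian_metric g := acm_metric acm.
Let lc := kenmotsu_levi_civita kenm.
Let nabla_conn : affine_connection nabla := lc_connection lc.
Let torsion_free := lc_torsion_free lc.

Lemma form_atD x u v : e x (u + v) = e x u + e x v.
Proof. by rewrite /form_at mulmxDr mxE. Qed.

Lemma form_atZ x a u : e x (a *: u) = a * e x u.
Proof. by rewrite /form_at -scalemxAr mxE. Qed.

Lemma form_atN x u : e x (- u) = - e x u.
Proof. by rewrite -scaleN1r form_atZ mulN1r. Qed.

Lemma eta_xi x : e x (xi x) = 1.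
Proof. exact: (acm_eta_xi acm). Qed.

Lemma phi_phi x u : phi x *m (phi x *m u) = - u + e x u *: xi x.
Proof. exact: (acm_phi2 acm). Qed.

Lemma phi_compat x u v : b x (phi x *m u) (phi x *m v) = b x u v - e x u * e x v.
Proof. exact: (acm_compatible acm). Qed.

Lemma phiB x u v : phi x *m (u - v) = phi x *m u - phi x *m v.
Proof. exact: mulmxBr. Qed.

(** From phi^2 xi = 0, the formula for phi^2 at phi xi makes phi xi a multiple c xi; then phi^2 xi =
    c^2 xi gives c = 0. *)
Lemma phi_xi x : phi x *m xi x = 0.
Proof.
set c := e x (phi x *m xi x).
have p2 : phi x *m (phi x *m xi x) = 0 by rewrite phi_phi eta_xi scale1r addNr.
have pE : phi x *m xi x = c *: xi x.
  have := phi_phi x (phi x *m xi x); rewrite p2 mulmx0 => E.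
  by apply/eqP; rewrite -subr_eq0 -oppr_eq0 opprB addrC -E.
have c0 : c = 0.
  have := p2; rewrite pE -scalemxAr pE scalerA => /(congr1 (e x)).
  rewrite form_atZ eta_xi mulr1 => E.
  have e0 : e x 0 = 0 by rewrite /form_at mulmx0 mxE.
  by apply/eqP; move: E; rewrite e0 => /eqP; rewrite mulf_eq0 orbb.
by rewrite pE c0 scale0r.
Qed.

Lemma eta_bil x u : e x u = b x u (xi x).
Proof.
have := phi_compat x u (xi x); rewrite phi_xi bil_at0r eta_xi mulr1 => /eqP.
by rewrite eq_sym subr_eq0 => /eqP ->.
Qed.

(** Compare phi(phi^2 u) with phi^2(phi u), using phi xi = 0. *)
Lemma eta_phi x u : e x (phi x *m u) = 0.
Proof.
have := congr1 (mulmx (phi x)) (phi_phi x u).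
rewrite phi_phi mulmxDr mulmxN -scalemxAr phi_xi scaler0 addr0.
move=> /(congr1 (fun v => e x (phi x *m u + v))).
rewrite addrA subrr add0r form_atZ eta_xi mulr1 => ->.
by rewrite /form_at mulmx0 mxE.
Qed.

Lemma phi_skew x u v : b x (phi x *m u) v = - b x u (phi x *m v).
Proof.
have := phi_compat x (phi x *m u) v; rewrite phi_phi eta_phi mul0r subr0 !bil_atE.
by rewrite (bil_atC gP _ (xi x)) -eta_bil eta_phi mulr0 addr0.
Qed.

Lemma bil_xi_xi x : b x (xi x) (xi x) = 1.
Proof. by rewrite -eta_bil eta_xi. Qed.

Lemma xi_smooth U : smooth_vf U xi.
Proof. by apply: smooth_vf_sub (acm_xi_smooth acm). Qed.

Lemma phi_smooth U X : open U -> smooth_vf U X -> smooth_vf U (fun y => phi y *m X y).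
Proof. exact: (acm_phi_smooth acm). Qed.

Lemma bil_smooth U X Y : open U -> smooth_vf U X -> smooth_vf U Y ->
  smooth_fun U (fun y => b y (X y) (Y y)).
Proof. exact: (metric_smooth gP). Qed.

Lemma eta_smooth U X : open U -> smooth_vf U X -> smooth_fun U (fun y => e y (X y)).
Proof. exact: (acm_eta_smooth acm). Qed.

Lemma dfun_bil U Y Z x u : open U -> U x -> smooth_vf U Y -> smooth_vf U Z ->
  dfun (fun y => b y (Y y) (Z y)) x u =
  b x (nabla x u Y) (Z x) + b x (Y x) (nabla x u Z).
Proof. by move=> oU Ux sY sZ; exact: (lc_metric lc oU sY sZ Ux). Qed.

Lemma nabla_phi U Y x u : open U -> U x -> smooth_vf U Y ->
  nabla x u (fun y => phi y *m Y y) =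
  phi x *m nabla x u Y + b x (phi x *m u) (Y x) *: xi x - e x (Y x) *: (phi x *m u).
Proof.
move=> oU0 U0x sY0; pose U' := U `&` dom (at_ x).
have oU : open U' by apply: openI => //; exact: open_dom.
have Ux : U' x by split=> //; exact: at_dom.
have sY : smooth_vf U' Y by apply: (smooth_vf_sub _ sY0) => y [].
have sE : smooth_vf U' (extend x u) by apply: (smooth_vf_sub _ (extend_smooth x u)) => y [].
have := kenmotsu_eq kenm oU sE sY Ux; rewrite /cov extend_at => /(canRL (subrK _)) ->.
by rewrite addrC addrA.
Qed.

(** Differentiating phi xi = 0 gives phi(nabla_u xi) = phi u. A second phi recovers nabla_u xi up to
    its xi-component, which vanishes because xi has unit length. *)
Lemma nabla_xi x u : nabla x u xi = u - e x u *: xi x.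
Proof.
have oT : open [set: M] by exact: openT.
have sxi : smooth_vf [set: M] xi by exact: xi_smooth.
have := nabla_phi u oT (I : [set: M] x) sxi.
have -> : (fun y => phi y *m xi y) = (fun=> 0 : 'cV[R]_m).
  by apply/funext => y; rewrite phi_xi.
have -> : nabla x u (fun=> 0) = 0.
  have := nablaZc nabla_conn 0 u oT sxi (I : [set: M] x).
  rewrite scale0r => E; apply: etrans E.
  by congr (nabla x u _); apply/funext => y; rewrite scale0r.
rewrite -eta_bil eta_phi scale0r addr0 eta_xi scale1r => /(congr1 (fun v => phi x *m v)).
rewrite mulmx0 mulmxBr !phi_phi.
have -> : e x (nabla x u xi) = 0.
  have := dfun_bil u oT (I : [set: M] x) sxi sxi.
  rewrite (_ : (fun y => b y (xi y) (xi y)) = fun=> 1); last first.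
    by apply/funext => y; exact: bil_xi_xi.
  rewrite dfun_cst (bil_atC gP x (xi x)) -eta_bil; lra.
rewrite scale0r addr0 => E; apply/eqP; rewrite -subr_eq0; apply/eqP.
rewrite -[LHS]opprK -[RHS]oppr0 [in RHS]E; congr (- _).
vring.
Qed.

(** The last two terms say that nabla e is b - e (x) e. This form is symmetric, so e is closed, a
    fact used for [dfun_potential]. *)
Lemma dfun_eta U Y x u : open U -> U x -> smooth_vf U Y ->
  dfun (fun y => e y (Y y)) x u = e x (nabla x u Y) + b x u (Y x) - e x u * e x (Y x).
Proof.
move=> oU Ux sY; have sxi : smooth_vf U xi by exact: xi_smooth.
rewrite (_ : (fun y => _) = fun y => b y (Y y) (xi y)); last first.
  by apply/funext => y; exact: eta_bil.
rewrite (dfun_bil u oU Ux sY sxi) nabla_xi bil_atDr bil_atNr bil_atZr -!eta_bil.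
by rewrite (bil_atC gP x (Y x)); ring.
Qed.

(** Apply [X, Y] to the function b(Z, W): the products of two first covariant derivatives are
    symmetric in X and Y and drop out. *)
Lemma curvature_metric U X Y Z W x : open U -> U x -> smooth_vf U X -> smooth_vf U Y ->
  smooth_vf U Z -> smooth_vf U W ->
  b x (curvature nabla X Y Z x) (W x) = - b x (curvature nabla X Y W x) (Z x).
Proof.
move=> oU Ux sX sY sZ sW.
have sZW := bil_smooth oU sZ sW.
have sbr := bracket_smooth nabla_conn torsion_free oU sX sY.
have H A B : smooth_vf U A -> smooth_vf U B ->
  dfun (fun y => dfun (fun z => b z (Z z) (W z)) y (B y)) x (A x) =
  b x (cov nabla A (cov nabla B Z) x) (W x) + b x (cov nabla B Z x) (cov nabla A W x) +
  (b x (cov nabla A Z x) (cov nabla B W x) + b x (Z x) (cov nabla A (cov nabla B W) x)).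
  move=> sA sB; have sBZ := cov_smooth nabla_conn oU sB sZ.
  have sBW := cov_smooth nabla_conn oU sB sW.
  rewrite -(dfun_bil (A x) oU Ux sBZ sW) -(dfun_bil (A x) oU Ux sZ sBW).
  apply: etrans _ (dfunD _ oU (bil_smooth oU sBZ sW) (bil_smooth oU sZ sBW) Ux).
  apply: (dfun_ext _ oU (dfun_smooth oU sZW sB) Ux) => y Uy.
  exact: (dfun_bil (B y) oU Uy sZ sW).
have := bracket_dfun oU Ux sZW sX sY.
rewrite (dfun_bil _ oU Ux sZ sW) (H X Y sX sY) (H Y X sY sX) -/(cov _ (bracket _ _) _ _).
rewrite -/(cov nabla (bracket X Y) W x) /curvature !bil_atE !(bil_atC gP x (Z x)).
by vgen; lra.
Qed.

Lemma curvature_xi U X Y x : open U -> U x -> smooth_vf U X -> smooth_vf U Y ->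
  curvature nabla X Y xi x = e x (X x) *: Y x - e x (Y x) *: X x.
Proof.
move=> oU Ux sX sY.
have sxi : smooth_vf U xi by exact: xi_smooth.
have H A B : smooth_vf U A -> smooth_vf U B -> cov nabla A (cov nabla B xi) x =
    cov nabla A B x - ((e x (cov nabla A B x) + b x (A x) (B x) - e x (A x) * e x (B x)) *: xi x
      + e x (B x) *: (A x - e x (A x) *: xi x)).
  move=> sA sB; have seB := eta_smooth oU sB.
  have sF : smooth_vf U (fun y => e y (B y) *: xi y) by exact: smooth_vfZ.
  have -> : cov nabla A (cov nabla B xi) x = nabla x (A x) (fun y => B y - e y (B y) *: xi y).
    apply: (nabla_local nabla_conn _ oU _ Ux); first exact: cov_smooth.
    by move=> y Uy; exact: nabla_xi.
  rewrite (nablaB nabla_conn _ oU sB sF Ux) (nablaZ nabla_conn _ oU seB sxi Ux).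
  by rewrite (dfun_eta _ oU Ux sB) nabla_xi.
have E : cov nabla (bracket X Y) xi x = (cov nabla X Y x - cov nabla Y X x)
    - (e x (cov nabla X Y x) - e x (cov nabla Y X x)) *: xi x.
  by rewrite /cov nabla_xi (bracketE torsion_free oU sX sY Ux) form_atD form_atN.
apply: etrans (sub3 (H X Y sX sY) (H Y X sY sX) E) _.
rewrite (bil_atC gP x (Y x)); vring.
Qed.

(** Both orders of differentiation are expanded by [nabla_phi]. Terms symmetric in X and Y cancel,
    those with nabla_X Y - nabla_Y X cancel against the bracket, and the algebraic rest is the
    commutator of K(X, Y) with phi. *)
Lemma curvature_phi U X Y Z x : open U -> U x -> smooth_vf U X -> smooth_vf U Y ->
  smooth_vf U Z ->
  curvature nabla X Y (fun y => phi y *m Z y) x =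
  phi x *m curvature nabla X Y Z x + b x (phi x *m Y x) (Z x) *: X x
  - b x (phi x *m X x) (Z x) *: Y x - b x (X x) (Z x) *: (phi x *m Y x)
  + b x (Y x) (Z x) *: (phi x *m X x).
Proof.
move=> oU Ux sX sY sZ.
have sxi : smooth_vf U xi by exact: xi_smooth.
have H A B : smooth_vf U A -> smooth_vf U B ->
    cov nabla A (cov nabla B (fun y => phi y *m Z y)) x =
    (phi x *m cov nabla A (cov nabla B Z) x
      + b x (phi x *m A x) (cov nabla B Z x) *: xi x - e x (cov nabla B Z x) *: (phi x *m A x))
    + ((b x (phi x *m cov nabla A B x) (Z x) + b x (phi x *m A x) (B x) * e x (Z x)
          - e x (B x) * b x (phi x *m A x) (Z x) + b x (phi x *m B x) (cov nabla A Z x)) *: xi x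
       + b x (phi x *m B x) (Z x) *: (A x - e x (A x) *: xi x))
    - ((e x (cov nabla A Z x) + b x (A x) (Z x) - e x (A x) * e x (Z x)) *: (phi x *m B x)
       + e x (Z x) *: (phi x *m cov nabla A B x + b x (phi x *m A x) (B x) *: xi x
                        - e x (B x) *: (phi x *m A x))).
  move=> sA sB.
  have sBZ := cov_smooth nabla_conn oU sB sZ.
  have sphB := phi_smooth oU sB.
  have seZ := eta_smooth oU sZ.
  have s1 := phi_smooth oU sBZ.
  have sb := bil_smooth oU sphB sZ.
  have s2 : smooth_vf U (fun y => b y (phi y *m B y) (Z y) *: xi y) by exact: smooth_vfZ.
  have s3 : smooth_vf U (fun y => e y (Z y) *: (phi y *m B y)) by exact: smooth_vfZ.
  have -> : cov nabla A (cov nabla B (fun y => phi y *m Z y)) x =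
     nabla x (A x) (fun y => (phi y *m cov nabla B Z y + b y (phi y *m B y) (Z y) *: xi y)
        - e y (Z y) *: (phi y *m B y)).
    apply: (nabla_local nabla_conn _ oU _ Ux).
      by apply: cov_smooth => //; exact: phi_smooth.
    by move=> y Uy; exact: (nabla_phi _ oU Uy sZ).
  rewrite (nablaB nabla_conn _ oU (smooth_vfD oU s1 s2) s3 Ux).
  rewrite (nablaD nabla_conn _ oU s1 s2 Ux).
  congr (_ + _ - _).
  - exact: (nabla_phi _ oU Ux sBZ).
  - rewrite (nablaZ nabla_conn _ oU sb sxi Ux) nabla_xi (dfun_bil _ oU Ux sphB sZ).
    rewrite (nabla_phi _ oU Ux sB) !bil_atE (bil_atC gP x (xi x)) -eta_bil -!/(cov _ _ _ _).
    by congr (_ *: _ + _); ring.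
  - rewrite (nablaZ nabla_conn _ oU seZ sphB Ux) (dfun_eta _ oU Ux sZ).
    by rewrite (nabla_phi _ oU Ux sB).
have E : cov nabla (bracket X Y) (fun y => phi y *m Z y) x =
    phi x *m cov nabla (bracket X Y) Z x
    + b x (phi x *m (cov nabla X Y x - cov nabla Y X x)) (Z x) *: xi x
    - e x (Z x) *: (phi x *m (cov nabla X Y x - cov nabla Y X x)).
  rewrite (torsion_free oU sX sY Ux); exact: (nabla_phi _ oU Ux sZ).
apply: etrans (sub3 (H X Y sX sY) (H Y X sY sX) E) _.
rewrite /curvature !phiB !bil_atE.
have -> : b x (phi x *m Y x) (X x) = - b x (phi x *m X x) (Y x).
  by rewrite phi_skew (bil_atC gP).
vring.
Qed.

End Kenmotsu.

(** * Pointwise curvature identities and the derivative of the curvature along xi *)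

Section KenmotsuCurvature.
Variables (R : realType) (m : nat) (M : manifold R m).
Variables (phi : M -> 'M[R]_m) (xi : vector_field M) (eta : M -> 'rV[R]_m).
Variables (g : M -> 'M[R]_m) (nabla : M -> 'cV[R]_m -> vector_field M -> 'cV[R]_m).
Hypothesis kenm : kenmotsu phi xi eta g nabla.
Implicit Types (U : set M) (x : M) (X Y Z W : vector_field M) (u v w : 'cV[R]_m).
Local Notation b := (bil_at g).
Local Notation e := (form_at eta).
Local Notation K := (curvature_at nabla).

Let acm := kenmotsu_acm kenm.
Let gP : riemannian_metric g := acm_metric acm.
Let lc := kenmotsu_levi_civita kenm.
Let nabla_conn : affine_connection nabla := lc_connection lc.
Let torsion_free := lc_torsion_free lc.
Let xiS := @xi_smooth _ _ _ _ _ _ _ _ kenm.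
Let ox x : open (dom (at_ x)) := @open_dom _ _ _ (at_ x).

Lemma curvature_at_metric x u v w z : b x (K x u v w) z = - b x (K x u v z) w.
Proof.
have := curvature_metric kenm (ox x) (at_dom x) (extend_smooth x u) (extend_smooth x v)
  (extend_smooth x w) (extend_smooth x z).
by rewrite !extend_at.
Qed.

Lemma curvature_at_xi x u v : K x u v (xi x) = e x u *: v - e x v *: u.
Proof.
have := curvature_xi kenm (ox x) (at_dom x) (extend_smooth x u) (extend_smooth x v).
rewrite (curvature_atE nabla_conn torsion_free (ox x) (at_dom x)
  (extend_smooth x u) (extend_smooth x v) (xiS _)).
by rewrite !extend_at.
Qed.

Lemma curvature_at_phi x u v w : K x u v (phi x *m w) = phi x *m K x u v w
  + b x (phi x *m v) w *: u - b x (phi x *m u) w *: v - b x u w *: (phi x *m v)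
  + b x v w *: (phi x *m u).
Proof.
have := curvature_phi kenm (ox x) (at_dom x) (extend_smooth x u) (extend_smooth x v)
  (extend_smooth x w).
rewrite !(curvature_atE nabla_conn torsion_free (ox x) (at_dom x)
  (extend_smooth x u) (extend_smooth x v)).
- by rewrite !extend_at.
- exact: extend_smooth.
- exact: (phi_smooth kenm (ox x) (extend_smooth x w)).
Qed.

Lemma curvature_at_xil x u v : K x (xi x) u v = e x v *: u - b x u v *: xi x.
Proof.
apply: (@curvature_k _ _ _ _ x gP (K x) _ _ _ (xi x) (e x)).
- by move=> *; exact: (curvature_at_skew nabla_conn).
- by move=> *; exact: (curvature_at_bianchi nabla_conn torsion_free).
- by move=> *; exact: curvature_at_metric.
- by move=> *; exact: (eta_bil kenm).
- by move=> *; exact: curvature_at_xi.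
Qed.

Lemma star_ricciE x u v :
  star_ricci nabla phi x u v = ricci nabla x u v + (m%:R - 2) * b x u v + e x u * e x v.
Proof.
apply: (@star_ricci_ricci _ _ _ _ x gP (K x) _ _ _ _ _ _ _ (phi x) (xi x) (e x)).
- by move=> *; exact: (curvature_atD1 nabla_conn torsion_free).
- by move=> *; exact: (curvature_atZ1 nabla_conn torsion_free).
- by move=> *; exact: (curvature_atD3 nabla_conn).
- by move=> *; exact: (curvature_atZ3 nabla_conn).
- by move=> *; exact: (curvature_at_skew nabla_conn).
- by move=> *; exact: (curvature_at_bianchi nabla_conn torsion_free).
- by move=> *; exact: curvature_at_metric.
- by move=> *; exact: (phi_phi kenm).
- by move=> *; exact: (phi_compat kenm).
- by move=> *; exact: (eta_bil kenm).
- by move=> *; exact: (phi_skew kenm).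
- by move=> *; exact: curvature_at_xi.
- by move=> *; exact: curvature_at_phi.
Qed.

(** In the second Bianchi identity with third field xi, every curvature with xi as an argument is
    explicit, and so is its derivative. The factor 2 comes from nabla_Y xi = Y - e(Y) xi inside
    [Y, xi] and its counterpart inside [xi, X]: each contributes one K(X, Y)Z. *)
Lemma nabla_xi_curvature U X Y Z x : open U -> U x -> smooth_vf U X ->
  smooth_vf U Y -> smooth_vf U Z ->
  nabla x (xi x) (curvature nabla X Y Z) =
  K x (nabla x (xi x) X) (Y x) (Z x) + K x (X x) (nabla x (xi x) Y) (Z x)
  + K x (X x) (Y x) (nabla x (xi x) Z)
  - 2 *: (K x (X x) (Y x) (Z x) + b x (Y x) (Z x) *: X x - b x (X x) (Z x) *: Y x).
Proof.
move=> oU Ux sX sY sZ.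
have sxi : smooth_vf U xi by exact: xiS.
have KE A B C : smooth_vf U A -> smooth_vf U B -> smooth_vf U C ->
    curvature nabla A B C x = K x (A x) (B x) (C x).
  by move=> sA sB sC; exact: (curvature_atE nabla_conn torsion_free oU Ux).
have sbr A B : smooth_vf U A -> smooth_vf U B -> smooth_vf U (bracket A B).
  by move=> sA sB; exact: (bracket_smooth nabla_conn torsion_free oU sA sB).
have scov A B : smooth_vf U A -> smooth_vf U B -> smooth_vf U (cov nabla A B).
  by move=> sA sB; exact: (cov_smooth nabla_conn oU sA sB).
have D A B : smooth_vf U A -> smooth_vf U B ->
    cov nabla A (curvature nabla xi B Z) x =
    ((e x (cov nabla A Z x) + b x (A x) (Z x) - e x (A x) * e x (Z x)) *: B x
      + e x (Z x) *: cov nabla A B x)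
    - ((b x (cov nabla A B x) (Z x) + b x (B x) (cov nabla A Z x)) *: xi x
       + b x (B x) (Z x) *: (A x - e x (A x) *: xi x)).
  move=> sA sB.
  have seZ := eta_smooth kenm oU sZ.
  have sb := bil_smooth kenm oU sB sZ.
  have s1 : smooth_vf U (fun y => e y (Z y) *: B y) by exact: smooth_vfZ.
  have s2 : smooth_vf U (fun y => b y (B y) (Z y) *: xi y) by exact: smooth_vfZ.
  have -> : cov nabla A (curvature nabla xi B Z) x =
      nabla x (A x) (fun y => e y (Z y) *: B y - b y (B y) (Z y) *: xi y).
    apply: (nabla_local nabla_conn _ oU _ Ux).
      exact: (curvature_smooth nabla_conn torsion_free oU sxi sB sZ).
    move=> y Uy; rewrite -curvature_at_xil.
    exact: (curvature_atE nabla_conn torsion_free oU Uy sxi sB sZ).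
  rewrite (nablaB nabla_conn _ oU s1 s2 Ux) (nablaZ nabla_conn _ oU seZ sB Ux).
  rewrite (nablaZ nabla_conn _ oU sb sxi Ux) (dfun_eta kenm _ oU Ux sZ).
  by rewrite (dfun_bil kenm _ oU Ux sB sZ) (nabla_xi kenm).
have D' A B : smooth_vf U A -> smooth_vf U B ->
    cov nabla A (curvature nabla B xi Z) x = - cov nabla A (curvature nabla xi B Z) x.
  move=> sA sB; have sc := curvature_smooth nabla_conn torsion_free oU sxi sB sZ.
  rewrite -[RHS](nablaN nabla_conn (A x) oU sc Ux).
  apply: (nabla_local nabla_conn _ oU _ Ux).
    exact: (curvature_smooth nabla_conn torsion_free oU sB sxi sZ).
  by move=> y Uy; exact: (curvature_skew nabla_conn oU Uy sB sxi sZ).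
have brE A B : smooth_vf U A -> smooth_vf U B ->
    bracket A B x = cov nabla A B x - cov nabla B A x.
  by move=> sA sB; exact: (bracketE torsion_free oU sA sB Ux).
have := bianchi2 nabla_conn torsion_free oU Ux sX sY sxi sZ.
rewrite (D' X Y sX sY) (D X Y sX sY) (D Y X sY sX).
rewrite (KE Y xi) ?(KE X (bracket Y xi)) ?(KE xi X) ?(KE Y (bracket xi X)) //;
  try by [exact: sbr|exact: scov].
rewrite (KE X Y) ?(KE xi (bracket X Y)) //; try by [exact: sbr|exact: scov].
rewrite !brE //.
have cxi A : cov nabla A xi x = A x - e x (A x) *: xi x by exact: (nabla_xi kenm).
rewrite !cxi.
have KB2 u v v' w : K x u (v - v') w = K x u v w - K x u v' w.
  rewrite (curvature_atD2 nabla_conn torsion_free) -scaleN1r.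
  by rewrite (curvature_atZ2 nabla_conn torsion_free) scaleN1r.
have Kxr u w : K x u (xi x) w = - (e x w *: u - b x u w *: xi x).
  by rewrite (curvature_at_skew nabla_conn) curvature_at_xil.
rewrite !KB2 !(curvature_atZ2 nabla_conn torsion_free) !Kxr !curvature_at_xil.
rewrite !(curvature_at_skew nabla_conn x (Y x)).
rewrite -!/(cov nabla xi _ x).
move=> E; apply/eqP; rewrite -subr_eq0; apply/eqP; apply: etrans E.
vring.
Qed.

Lemma dfun_star_ricci U X Y x : open U -> U x -> smooth_vf U X -> smooth_vf U Y ->
  dfun (fun y => star_ricci nabla phi y (X y) (Y y)) x (xi x) =
  star_ricci nabla phi x (nabla x (xi x) X) (Y x)
  + star_ricci nabla phi x (X x) (nabla x (xi x) Y)
  - 2 * star_ricci nabla phi x (X x) (Y x)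
  - 2 * (b x (X x) (Y x) - e x (X x) * e x (Y x)).
Proof.
move=> oU Ux sX sY.
have sphY := phi_smooth kenm oU sY.
pose L y w := K y (X y) (phi y *m Y y) (phi y *m w).
have LD y u v : L y (u + v) = L y u + L y v.
  by rewrite /L mulmxDr (curvature_atD3 nabla_conn).
have LZ y a u : L y (a *: u) = a *: L y u.
  by rewrite /L -scalemxAr (curvature_atZ3 nabla_conn).
(* [dfun_trace] needs a matrix field; [T] represents w |-> K(X, phi Y)phi w, whose trace is 2 S'(X,
   Y). *)
have [T TE] : exists T : M -> 'M[R]_m, (forall y w, T y *m w = L y w) /\
    (forall y, \tr (T y) = endo_trace (L y)).
  exists (fun y => lin_mx_of (L y)); split=> // y w.
  exact: (lin_mx_ofE _ (LD y) (LZ y)).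
case: TE => TE trT.
have TF V Z y : open V -> V `<=` U -> smooth_vf V Z -> V y ->
    T y *m Z y = curvature nabla X (fun z => phi z *m Y z) (fun z => phi z *m Z z) y.
  move=> oV VU sZ Vy; rewrite TE; symmetry.
  exact: (curvature_atE nabla_conn torsion_free oV Vy (smooth_vf_sub VU sX)
    (smooth_vf_sub VU sphY) (phi_smooth kenm oV sZ)).
have sT V Z : open V -> V `<=` U -> smooth_vf V Z -> smooth_vf V (fun y => T y *m Z y).
  move=> oV VU sZ; apply: (smooth_vf_ext oV (fun y Vy => esym (TF V Z y oV VU sZ Vy))).
  exact: (curvature_smooth nabla_conn torsion_free oV (smooth_vf_sub VU sX)
    (smooth_vf_sub VU sphY) (phi_smooth kenm oV sZ)).
have starE y : star_ricci nabla phi y (X y) (Y y) = 2^-1 * \tr (T y) by rewrite trT.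
have -> : dfun (fun y => star_ricci nabla phi y (X y) (Y y)) x (xi x) =
    2^-1 * dfun (fun y => \tr (T y)) x (xi x).
  rewrite (_ : (fun y => _) = (fun y => 2^-1 * \tr (T y))); last exact/funext.
  rewrite (dfunM _ oU (@smooth_fun_cst _ _ _ U _) (mxtrace_smooth oU sT) Ux).
  by rewrite dfun_cst mulr0 addr0.
rewrite (dfun_trace nabla_conn (xi x) oU Ux sT).
have nphi V Z : open V -> V x -> smooth_vf V Z ->
    nabla x (xi x) (fun y => phi y *m Z y) = phi x *m nabla x (xi x) Z.
  move=> oV Vx sZ; rewrite (nabla_phi kenm _ oV Vx sZ) (phi_xi kenm) bil_at0l.
  by rewrite scale0r scaler0 addr0 subr0.
pose V := U `&` dom (at_ x).
have oV : open V by apply: openI => //; exact: open_dom.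
have Vx : V x by split=> //; exact: at_dom.
have VU : V `<=` U by move=> y [].
have phD u v : phi x *m (u + v) = phi x *m u + phi x *m v by exact: mulmxDr.
have phZ a u : phi x *m (a *: u) = a *: (phi x *m u) by rewrite -scalemxAr.
pose A1 w := K x (nabla x (xi x) X) (phi x *m Y x) (phi x *m w).
pose A2 w := K x (X x) (phi x *m nabla x (xi x) Y) (phi x *m w).
pose h1 w := b x (phi x *m Y x) (phi x *m w).
pose h2 w := b x (X x) (phi x *m w).
have -> : endo_trace (fun w => nabla x (xi x) (fun y => T y *m extend x w y)
      - T x *m nabla x (xi x) (extend x w)) =
    endo_trace A1 + endo_trace A2 - 2 * (endo_trace (L x) + (h1 (X x) - h2 (phi x *m Y x))).
  rewrite -(endo_trace_comb A1 A2 (L x) (h1 := h1) (h2 := h2)); first last.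
  - by move=> *; rewrite /h2 phZ bil_atZr.
  - by move=> *; rewrite /h2 phD bil_atDr.
  - by move=> *; rewrite /h1 phZ bil_atZr.
  - by move=> *; rewrite /h1 phD bil_atDr.
  apply: eq_endo_trace => w; have sE : smooth_vf V (extend x w).
    by apply: (smooth_vf_sub _ (extend_smooth x w)) => y [].
  rewrite (nabla_local nabla_conn _ oV (sT V _ oV VU sE) Vx
    (fun y Vy => TF V _ y oV VU sE Vy)).
  rewrite (nabla_xi_curvature oV Vx (smooth_vf_sub VU sX) (smooth_vf_sub VU sphY)
    (phi_smooth kenm oV sE)).
  rewrite TE /L (nphi V _ oV Vx sE) (nphi U Y oU Ux sY) extend_at /A1 /A2 /h1 /h2.
  by vring.
rewrite /h1 /h2 (bil_atC gP x (phi x *m Y x)).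
(* The two rank-one traces are opposite, so their difference is twice b(phi X, phi Y), that is,
   twice b - e (x) e on X and Y. *)
have -> : b x (X x) (phi x *m (phi x *m Y x)) = - b x (phi x *m X x) (phi x *m Y x).
  by rewrite (phi_skew kenm) opprK.
rewrite (phi_compat kenm).
have key (t1 t2 t3 q s1 s2 s3 : R) : s1 = 2^-1 * t1 -> s2 = 2^-1 * t2 -> s3 = 2^-1 * t3 ->
    2^-1 * (t1 + t2 - 2 * (t3 + (q - - q))) = s1 + s2 - 2 * s3 - 2 * q.
  by move=> -> -> ->; field.
by apply: key.
Qed.

End KenmotsuCurvature.

(** * Gradient almost *-Ricci solitons *)

Section Soliton.
Variables (R : realType) (m : nat) (M : manifold R m).
Variables (phi : M -> 'M[R]_m) (xi : vector_field M) (eta : M -> 'rV[R]_m).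
Variables (g : M -> 'M[R]_m) (nabla : M -> 'cV[R]_m -> vector_field M -> 'cV[R]_m).
Hypothesis kenm : kenmotsu phi xi eta g nabla.
Variables f lambda : M -> R.
Hypotheses (f_smooth : smooth_fun setT f) (lambda_smooth : smooth_fun setT lambda).
Hypothesis soliton : forall x u v, hess g nabla f x u v + star_ricci nabla phi x u v
  + lambda x * bil_at g x u v = 0.
Implicit Types (U : set M) (x : M) (X Y Z W : vector_field M) (u v w : 'cV[R]_m).
Local Notation b := (bil_at g).
Local Notation e := (form_at eta).
Local Notation K := (curvature_at nabla).
Local Notation S' := (star_ricci nabla phi).
Local Notation Df := (grad g f).

Let gP : riemannian_metric g := acm_metric (kenmotsu_acm kenm).
Let lc := kenmotsu_levi_civita kenm.
Let nabla_conn : affine_connection nabla := lc_connection lc.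
Let torsion_free := lc_torsion_free lc.
Let xiS := @xi_smooth _ _ _ _ _ _ _ _ kenm.
Let ox x : open (dom (at_ x)) := @open_dom _ _ _ (at_ x).

Let fS U : smooth_fun U f.
Proof. exact: smooth_fun_sub f_smooth. Qed.

Let lS U : smooth_fun U lambda.
Proof. exact: smooth_fun_sub lambda_smooth. Qed.

Let DfS U : smooth_vf U Df.
Proof. by apply: (smooth_vf_sub _ (grad_smooth gP openT f_smooth)). Qed.

Lemma star_ricci_hess x u v : S' x u v = - b x (nabla x u Df) v - lambda x * b x u v.
Proof. by have := soliton x u v; rewrite /hess; vgen; move: (S' x u v) => *; lra. Qed.

(** b(nabla_u Df, v) is a second derivative of [f] minus the derivative of [f] along nabla_u v; its
    skew part vanishes because the torsion does. *)
Lemma hess_sym x u v : b x (nabla x u Df) v = b x (nabla x v Df) u.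
Proof.
have D u1 u2 : b x (nabla x u1 Df) u2 =
    dfun (fun y => dfun f y (extend x u2 y)) x u1 - dfun f x (nabla x u1 (extend x u2)).
  have E0 : dfun (fun y => b y (Df y) (extend x u2 y)) x u1 =
      dfun (fun y => dfun f y (extend x u2 y)) x u1.
    apply: (dfun_ext _ (ox x) _ (at_dom x)).
      by apply: (bil_smooth kenm (ox x)); [exact: DfS|exact: extend_smooth].
    by move=> y _; exact: (bil_grad gP).
  have E1 := dfun_bil kenm u1 (ox x) (at_dom x) (DfS _) (extend_smooth x u2).
  have E2 := bil_grad gP f x (nabla x u1 (extend x u2)).
  have key (p q r s t : R) : s = t -> s = p + q -> q = r -> p = t - r.
    by move=> <- -> <-; rewrite addrK.
  by have := key _ _ _ _ _ E0 E1 E2; rewrite extend_at.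
rewrite (D u v) (D v u).
have := bracket_dfun (ox x) (at_dom x) (fS _) (extend_smooth x u) (extend_smooth x v).
rewrite (bracketE torsion_free (ox x) (extend_smooth x u) (extend_smooth x v) (at_dom x)).
by rewrite dfunBr !extend_at; vgen; lra.
Qed.

(** Inherited from the Hessian through the soliton equation. *)
Lemma star_ricci_sym x u v : S' x u v = S' x v u.
Proof. by rewrite !star_ricci_hess hess_sym (bil_atC gP x u v). Qed.

Lemma star_ricci_xi x u : S' x u (xi x) = 0.
Proof.
rewrite /star_ricci (phi_xi kenm) (eq_endo_trace (B := fun w => 0 *: w)) => [|w].
  by rewrite endo_traceZ mul0r mulr0.
have := curvature_atZ2 nabla_conn torsion_free x 0 u 0 (phi x *m w).
by rewrite !scale0r => ->.
Qed.

(** With [star_ricci_xi] and symmetry, only the lambda term is left in the soliton equation along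
    xi. *)
Lemma nabla_xi_grad x : nabla x (xi x) Df = - lambda x *: xi x.
Proof.
apply: (bil_at_inj gP (x := x)) => v.
have := star_ricci_hess x (xi x) v; rewrite star_ricci_sym star_ricci_xi.
by rewrite !bil_atE; vgen; lra.
Qed.

Definition potential x := dfun f x (xi x) + dfun lambda x (xi x).

Lemma potential_smooth U : open U -> smooth_fun U potential.
Proof.
move=> oU; apply: smooth_funD => //.
  exact: (dfun_smooth oU (fS U) (xiS U)).
exact: (dfun_smooth oU (lS U) (xiS U)).
Qed.

(** Two values of (nabla_xi S')(u, v) are compared. The soliton equation yields - a b(u, v) + d(f +
    lambda)(u) e(v) - S'(u, v), while [dfun_star_ricci] yields - 2 S' - 2 (b - e (x) e); S' survives
    with coefficient 1. *)
Lemma star_ricci_potential_aux x u v : S' x u v =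
  potential x * b x u v - (dfun f x u + dfun lambda x u) * e x v
  - 2 * (b x u v - e x u * e x v).
Proof.
pose U := dom (at_ x); have oU : open U by exact: ox.
have Ux : U x by exact: at_dom.
pose X := extend x u; pose Y := extend x v.
have sX : smooth_vf U X by exact: extend_smooth.
have sY : smooth_vf U Y by exact: extend_smooth.
have sxi : smooth_vf U xi by exact: xiS.
have sDf : smooth_vf U Df by exact: DfS.
have sXDf := cov_smooth nabla_conn oU sX sDf.
have Xx : X x = u by exact: extend_at.
have Yx : Y x = v by exact: extend_at.
have := dfun_star_ricci kenm oU Ux sX sY.
have sb := bil_smooth kenm oU sX sY.
have sb1 := bil_smooth kenm oU sXDf sY.
have sb1N := smooth_funN oU sb1.
have -> : dfun (fun y => S' y (X y) (Y y)) x (xi x) =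
    - (b x (nabla x (xi x) (cov nabla X Df)) (Y x) + b x (nabla x (X x) Df) (nabla x (xi x) Y))
    - (dfun lambda x (xi x) * b x (X x) (Y x)
       + lambda x * (b x (nabla x (xi x) X) (Y x) + b x (X x) (nabla x (xi x) Y))).
  rewrite (_ : (fun y => S' y (X y) (Y y)) = fun y => - b y (cov nabla X Df y) (Y y)
     - lambda y * b y (X y) (Y y)); last by apply/funext => y; exact: star_ricci_hess.
  apply: etrans (dfunB _ oU sb1N (smooth_funM oU (lS U) sb) Ux) _.
  congr (_ - _).
    apply: etrans (dfunN _ oU sb1 Ux) _; congr (- _).
    exact: (dfun_bil kenm _ oU Ux sXDf sY).
  apply: etrans (dfunM _ oU (lS U) sb Ux) _.
  rewrite (dfun_bil kenm _ oU Ux sX sY); ring.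
(* The derivatives are exchanged because nabla_xi Df is explicit; the price K(xi, X)Df is explicit
   too. [E2], [E3] and [E4] evaluate the three summands. *)
have E1 : nabla x (xi x) (cov nabla X Df) = curvature nabla xi X Df x
    + cov nabla X (cov nabla xi Df) x + cov nabla (bracket xi X) Df x.
  by rewrite /curvature -/(cov nabla xi (cov nabla X Df) x); vring.
have E2 : cov nabla X (cov nabla xi Df) x =
    - dfun lambda x u *: xi x - lambda x *: (u - e x u *: xi x).
  have slN := smooth_funN oU (lS U).
  have -> : cov nabla X (cov nabla xi Df) x = nabla x (X x) (fun y => - lambda y *: xi y).
    apply: (nabla_local nabla_conn _ oU _ Ux).
      exact: (cov_smooth nabla_conn oU sxi sDf).
    by move=> y _; exact: nabla_xi_grad.
  rewrite (nablaZ nabla_conn _ oU slN sxi Ux) (nabla_xi kenm) (dfunN _ oU (lS U) Ux) Xx.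
  vring.
have E3 : cov nabla (bracket xi X) Df x =
    nabla x (nabla x (xi x) X) Df - nabla x u Df + e x u *: (- lambda x *: xi x).
  rewrite /cov (bracketE torsion_free oU sxi sX Ux) (nabla_xi kenm) Xx.
  rewrite !(nablaBl nabla_conn _ _ oU sDf Ux) (nablaZl nabla_conn _ _ oU sDf Ux).
  by rewrite nabla_xi_grad opprB addrA addrAC.
have E4 : curvature nabla xi X Df x = dfun f x (xi x) *: u - dfun f x u *: xi x.
  rewrite (curvature_atE nabla_conn torsion_free oU Ux sxi sX sDf).
  by rewrite (curvature_at_xil kenm) Xx (eta_bil kenm) (bil_atC gP x u) !(bil_grad gP).
rewrite E1 E2 E3 E4 Xx Yx !bil_atE !(star_ricci_hess x (nabla x (xi x) X)).
rewrite !(star_ricci_hess x u (nabla x (xi x) Y)).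
rewrite (bil_atC gP x (xi x) v) -(eta_bil kenm).
have := star_ricci_hess x u v; rewrite /potential.
move: (b x (nabla x u Df) v) (b x (nabla x (nabla x (xi x) X) Df) v).
move: (b x (nabla x u Df) (nabla x (xi x) Y)) (b x (nabla x (xi x) X) v).
move: (b x u (nabla x (xi x) Y)) (S' x u v) => q1 q2 q3 q4 q5 q6.
by vgen; move=> -> /(canRL (addrK _)); lra.
Qed.

(** At v = xi, both S' and the form b - e (x) e vanish in the preceding identity. *)
Lemma dfun_potential_eta x u : dfun f x u + dfun lambda x u = potential x * e x u.
Proof.
have := star_ricci_potential_aux x u (xi x).
rewrite star_ricci_xi (eta_xi kenm) -(eta_bil kenm); vgen; move: (potential x) => *; lra.
Qed.

Lemma star_ricci_potential x u v :
  S' x u v = (potential x - 2) * (b x u v - e x u * e x v).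
Proof. by rewrite star_ricci_potential_aux dfun_potential_eta; ring. Qed.

(** Apply d to d(f + lambda) = a e: since e is closed, the wedge of da with e is zero, and
    evaluating it on [u] and xi gives the claim. Here d^2 = 0 takes the form of [bracket_dfun]. *)
Lemma dfun_potential x u : dfun potential x u = dfun potential x (xi x) * e x u.
Proof.
pose U := dom (at_ x); have oU : open U by exact: ox.
have Ux : U x by exact: at_dom.
pose X := extend x u.
have sX : smooth_vf U X by exact: extend_smooth.
have sxi : smooth_vf U xi by exact: xiS.
have Xx : X x = u by exact: extend_at.
have sa := potential_smooth oU.
pose h y := f y + lambda y.
have sh : smooth_fun U h by exact: (smooth_funD oU (fS U) (lS U)).
have dh y v : U y -> dfun h y v = potential y * e y v.
  move=> Uy; rewrite -dfun_potential_eta.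
  exact: (dfunD v oU (fS U) (lS U) Uy).
have seX := eta_smooth kenm oU sX.
have := bracket_dfun oU Ux sh sX sxi.
have -> : dfun (fun y => dfun h y (xi y)) x (X x) = dfun potential x u.
  rewrite Xx; apply: (dfun_ext _ oU (dfun_smooth oU sh sxi) Ux) => y Uy.
  by rewrite (dh y _ Uy) (eta_xi kenm) mulr1.
have -> : dfun (fun y => dfun h y (X y)) x (xi x) =
    potential x * (e x (nabla x (xi x) X)) + e x u * dfun potential x (xi x).
  transitivity (dfun (fun y => potential y * e y (X y)) x (xi x)).
    by apply: (dfun_ext _ oU (dfun_smooth oU sh sX) Ux) => y Uy; exact: dh.
  rewrite (dfunM _ oU sa seX Ux) (dfun_eta kenm _ oU Ux sX) (eta_xi kenm) Xx.
  by rewrite (bil_atC gP x (xi x)) -(eta_bil kenm); ring.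
rewrite (dh x _ Ux) (bracketE torsion_free oU sX sxi Ux) (nabla_xi kenm) Xx.
rewrite !(form_atD, form_atN, form_atZ) (eta_xi kenm).
vgen; move: (potential x) => *; lra.
Qed.

Lemma nabla_grad x u : nabla x u Df =
  - (potential x - 2 + lambda x) *: u + ((potential x - 2) * e x u) *: xi x.
Proof.
apply: (bil_at_inj gP (x := x)) => v.
have := star_ricci_hess x u v; rewrite star_ricci_potential => E.
rewrite !bil_atE (bil_atC gP x (xi x)) -(eta_bil kenm).
move: E; vgen; move: (potential x) => p E; lra.
Qed.

(** Covariant derivatives of the explicit [nabla_grad] are commuted. The coefficient of the first
    term collects xi a from da, a from d lambda = a e - df, and a - 2 from nabla xi. *)
Lemma curvature_grad x u v : K x u v (Df x) =
  - (dfun potential x (xi x) + 2 * potential x - 2) *: (e x u *: v - e x v *: u)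
  + (dfun f x u *: v - dfun f x v *: u).
Proof.
pose U := dom (at_ x); have oU : open U by exact: ox.
have Ux : U x by exact: at_dom.
pose X := extend x u; pose Y := extend x v.
have sX : smooth_vf U X by exact: extend_smooth.
have sY : smooth_vf U Y by exact: extend_smooth.
have sxi : smooth_vf U xi by exact: xiS.
have sDf : smooth_vf U Df by exact: DfS.
have sa := potential_smooth oU.
have sc : smooth_fun U (fun y => potential y - 2).
  by apply: smooth_funB => //; exact: smooth_fun_cst.
have scl := smooth_funD oU sc (lS U).
have sclN := smooth_funN oU scl.
have H A B : smooth_vf U A -> smooth_vf U B -> cov nabla A (cov nabla B Df) x =
    (- (dfun potential x (A x) + dfun lambda x (A x)) *: B x
       - (potential x - 2 + lambda x) *: cov nabla A B x)
    + ((((potential x - 2) * (e x (cov nabla A B x) + b x (A x) (B x) - e x (A x) * e x (B x))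
        + e x (B x) * dfun potential x (A x)) *: xi x)
       + ((potential x - 2) * e x (B x)) *: (A x - e x (A x) *: xi x)).
  move=> sA sB.
  have seB := eta_smooth kenm oU sB.
  have sce := smooth_funM oU sc seB.
  have s1 : smooth_vf U (fun y => - (potential y - 2 + lambda y) *: B y) by exact: smooth_vfZ.
  have s2 : smooth_vf U (fun y => ((potential y - 2) * e y (B y)) *: xi y) by exact: smooth_vfZ.
  have -> : cov nabla A (cov nabla B Df) x = nabla x (A x) (fun y =>
      - (potential y - 2 + lambda y) *: B y + ((potential y - 2) * e y (B y)) *: xi y).
    apply: (nabla_local nabla_conn _ oU _ Ux).
      exact: (cov_smooth nabla_conn oU sB sDf).
    by move=> y _; exact: nabla_grad.
  have dc w : dfun (fun y => potential y - 2) x w = dfun potential x w.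
    by rewrite (dfunB _ oU sa (@smooth_fun_cst _ _ _ U 2) Ux) dfun_cst subr0.
  rewrite (nablaD nabla_conn _ oU s1 s2 Ux); congr (_ + _).
    rewrite (nablaZ nabla_conn _ oU sclN sB Ux) (dfunN _ oU scl Ux).
    by rewrite (dfunD _ oU sc (lS U) Ux) dc !scaleNr.
  rewrite (nablaZ nabla_conn _ oU sce sxi Ux) (nabla_xi kenm).
  by rewrite (dfunM _ oU sc seB Ux) dc (dfun_eta kenm _ oU Ux sB).
have H3 : cov nabla (bracket X Y) Df x =
    - (potential x - 2 + lambda x) *: (cov nabla X Y x - cov nabla Y X x)
    + ((potential x - 2) * (e x (cov nabla X Y x) - e x (cov nabla Y X x))) *: xi x.
  rewrite /cov nabla_grad (bracketE torsion_free oU sX sY Ux).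
  by rewrite form_atD form_atN.
have <- : curvature nabla X Y Df x = K x u v (Df x).
  by rewrite (curvature_atE nabla_conn torsion_free oU Ux sX sY sDf) /X /Y !extend_at.
apply: etrans (sub3 (H X Y sX sY) (H Y X sY sX) H3) _.
have l w : dfun lambda x w = potential x * e x w - dfun f x w.
  by rewrite -dfun_potential_eta addrAC subrr add0r.
rewrite !l !(dfun_potential x (X x)) !(dfun_potential x (Y x)).
have -> : X x = u by exact: extend_at.
have -> : Y x = v by exact: extend_at.
rewrite (bil_atC gP x v u).
move: (potential x) => p.
vring.
Qed.

Lemma ricci_grad x v : ricci nabla x v (Df x) = (m%:R - 1) *
  ((dfun potential x (xi x) + 2 * potential x - 2) * e x v - dfun f x v).
Proof.
set c := dfun potential x (xi x) + 2 * potential x - 2.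
rewrite /ricci (eq_endo_trace (B := fun w => (c * e x v - dfun f x v) *: w
    + (dfun f x w *: v - (c * e x w) *: v))) => [|w]; last first.
  by rewrite curvature_grad -/c; move: c => c'; vring.
rewrite endo_traceD endo_traceB endo_traceZ endo_trace_id.
rewrite (endo_trace_rank1 (h := dfun f x)); first last.
- by move=> *; exact: dfunZr.
- by move=> *; exact: dfunDr.
rewrite (endo_trace_rank1 (h := fun w => c * e x w)); first last.
- by move=> *; rewrite form_atZ; ring.
- by move=> *; rewrite form_atD mulrDr.
move: c => c'; vgen; ring.
Qed.

(** S'(v, Df) is computed by [star_ricci_potential] and by [star_ricciE] with [ricci_grad]. The
    passage from a - 2 to a - 1 is the difference (m - 1) - (m - 2) of the coefficients of v f. *)
Lemma potential_dichotomy x v :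
  (potential x - 1) * (dfun f x v - e x v * dfun f x (xi x)) = 0.
Proof.
have H w : (potential x - 1) * (dfun f x w - e x w * dfun f x (xi x)) =
    (m%:R - 1) * (dfun potential x (xi x) + 2 * potential x - 2) * e x w.
  have := star_ricciE kenm x w (Df x).
  rewrite star_ricci_potential ricci_grad (bil_atC gP x w) (bil_grad gP).
  rewrite (eta_bil kenm x (Df x)) (bil_grad gP).
  by move: (potential x) => p; vgen => E; lra.
(* At w = xi the left-hand side of [H] is zero and e(xi) = 1, so the coefficient on the right
   vanishes, and with it the right-hand side for every [w]. *)
rewrite H; suff -> : (m%:R - 1) * (dfun potential x (xi x) + 2 * potential x - 2) = 0.
  by rewrite mul0r.
have := H (xi x); rewrite (eta_xi kenm).
by move: (potential x) => p; vgen => E; lra.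
Qed.

(** Here S' = - (b - e (x) e), so the terms e (x) e cancel in [star_ricciE]. *)
Lemma ricci_potential_eq1 x u v : potential x = 1 ->
  ricci nabla x u v = - (m%:R - 1) * b x u v.
Proof.
move=> a1; have := star_ricciE kenm x u v; rewrite star_ricci_potential a1.
by move: (ricci nabla x u v) => r; vgen => E; lra.
Qed.

Lemma einstein_or_collinear : einstein g nabla \/
  exists O : set M, [/\ open O, O !=set0 &
    exists2 h : M -> R, smooth_fun O h & forall x, O x -> Df x = h x *: xi x].
Proof.
(* One Einstein constant must serve all points, so the alternative is whether [potential] is
   identically 1, not its value at a given point. *)
have [H|/existsNP [x0 a0]] := pselect (forall x, potential x = 1).
  by left; exists (- (m%:R - 1)) => x u v; exact: ricci_potential_eq1.
right; pose O := [set x : M | potential x != 1].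
have oO : open O.
  rewrite openE => x /= ax.
  have s1 : smooth_fun [set: M] (fun y => potential y - 1).
    by apply: smooth_funB (openT) (potential_smooth openT) (smooth_fun_cst _ _).
  have c1 : {for x, continuous (fun y => potential y - 1)}.
    exact: (smooth_fun_continuous openT (I : [set: M] x) s1).
  have := cvgr_neq0 _ c1; rewrite subr_eq0 => /(_ _ ax).
  by apply: filterS => y; rewrite subr_eq0.
exists O; split=> //; first by exists x0; apply/eqP.
exists (fun x => dfun f x (xi x)).
  exact: (dfun_smooth oO (fS O) (xiS O)).
move=> x /= ax; apply: (bil_at_inj gP (x := x)) => v.
rewrite (bil_grad gP) bil_atZl (bil_atC gP x (xi x)) -(eta_bil kenm).
have := potential_dichotomy x v => /eqP; rewrite mulf_eq0 subr_eq0 (negPf ax) /=.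
by rewrite subr_eq0 mulrC => /eqP.
Qed.

End Soliton.

Theorem theorem4p1 (R : realType) (n : nat) (n_ge1 : (1 <= n)%N)
    (M : manifold R n.*2.+1)
    (phi : M -> 'M[R]_(n.*2.+1)) (xi : vector_field M)
    (eta : M -> 'rV[R]_(n.*2.+1)) (g : M -> 'M[R]_(n.*2.+1))
    (nabla : M -> 'cV[R]_(n.*2.+1) -> vector_field M -> 'cV[R]_(n.*2.+1))
    (M_kenmotsu : kenmotsu phi xi eta g nabla)
    (f lambda : M -> R)
    (f_smooth : smooth_fun setT f) (lambda_smooth : smooth_fun setT lambda)
    (soliton : forall (x : M) (u v : 'cV[R]_(n.*2.+1)),
      hess g nabla f x u v + star_ricci nabla phi x u v
      + lambda x * bil_at g x u v = 0) :
  einstein g nabla \/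
  exists O : set M, [/\ open O, O !=set0 &
    exists2 h : M -> R, smooth_fun O h &
      forall x, O x -> grad g f x = h x *: xi x].
Proof. exact: (einstein_or_collinear M_kenmotsu f_smooth lambda_smooth soliton). Qed.
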